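(* Let $\mathcal{A}=(\mathcal{S}_1(\mathcal{H}),\boxtimes)$, where $\mathcal{H}=L^2(\mathbb{R}^\times,dt/|t|)$, and let $P_{\rm diag}:\mathcal{H}\widehat{\otimes}\overline{\mathcal{H}}\to\mathcal{H}\widehat{\otimes}\overline{\mathcal{H}}$ be the bounded linear map determined by $P_{\rm diag}(\xi\otimes\eta)=P^+\xi\otimes P^+\eta+P^-\xi\otimes P^-\eta$. Then $P_{\rm diag}$ is a homomorphism with respect to $\boxtimes$; that is, $P_{\rm diag}(T_1\boxtimes T_2)=P_{\rm diag}(T_1)\boxtimes P_{\rm diag}(T_2)$ for all $T_1,T_2\in\mathcal{A}$.
   Context: $\mathbb{R}^\times$ is the multiplicative group of non-zero reals with Haar measure $dt/|t|$; $\mathcal{H}=L^2(\mathbb{R}^\times,dt/|t|)$. $\overline{\mathcal{H}}$ is the conjugate Hilbert space; $\mathcal{H}\widehat{\otimes}\overline{\mathcal{H}}$ (projective tensor product) is identified with the trace-class operators $\mathcal{S}_1(\mathcal{H})$, with $\xi\otimes\eta$ corresponding to $\alpha\mapsto\langle\alpha,\eta\rangle\xi$ (inner product linear in the first variable). For $r\in\mathbb{R}^\times$, $(\lambda(r)\xi)(t)=\xi(r^{-1}t)$, and $f\cdot g$ is the pointwise product. Dual convolution $\boxtimes$ is the unique contractive bilinear map $\mathcal{S}_1(\mathcal{H})\times\mathcal{S}_1(\mathcal{H})\to\mathcal{S}_1(\mathcal{H})$ satisfying $$(\xi\otimes\eta)\boxtimes(\xi'\otimes\eta')=\int_{\mathbb{R}^\times}\bigl(\lambda(1+h)\xi\cdot\lambda(1+h^{-1})\xi'\bigr)\otimes\bigl(\lambda(1+h)\eta\cdot\lambda(1+h^{-1})\eta'\bigr)\,\frac{dh}{|h|}$$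 (a Bochner integral in $\mathcal{H}\widehat{\otimes}\overline{\mathcal{H}}$); it makes $\mathcal{S}_1(\mathcal{H})$ into a commutative Banach algebra $\mathcal{A}$. $\mathcal{H}^+=\{\xi\in\mathcal{H}:\xi(t)=0\text{ for a.e. }t<0\}$, $\mathcal{H}^-=\{\xi\in\mathcal{H}:\xi(t)=0\text{ for a.e. }t>0\}$, and $P^\pm$ is the orthogonal projection of $\mathcal{H}$ onto $\mathcal{H}^\pm$. *)

(* Defs.v *)
From HB Require Import structures.
From mathcomp Require Import all_boot all_order all_algebra.
From mathcomp Require Import generic_quotient ring_quotient complex.
From mathcomp Require Import all_classical all_reals all_analysis.
From mathcomp Require Import measurable_realfun.

Set Implicit Arguments.
Unset Strict Implicit.
Unset Printing Implicit Defensive.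
Import Order.TTheory GRing.Theory Num.Theory.
Import numFieldNormedType.Exports.
Local Open Scope classical_set_scope.
Local Open Scope ring_scope.
Local Open Scope complex_scope.

Section HaarMeasure.
Context (R : realType).

(* The Haar measure dt/|t| of R^x, carried by the whole line: {0} is a null set,
   so functions on R^x modulo a.e. equality are functions on R modulo
   haar-a.e. equality, and junk values at t = 0 (0^-1 = 0) never matter. *)
Definition haar (A : set (measurableTypeR R)) : \bar R :=
  (\int[lebesgue_measure]_(t in A) (`|t|^-1)%:E)%E.

Let haar0 : haar set0 = 0%E.
Proof. by rewrite /haar integral_set0. Qed.

Let haar_ge0 A : (0 <= haar A)%E.
Proof. by apply: integral_ge0 => x _; rewrite lee_fin invr_ge0. Qed.

Lemma measurable_norm_inv (D : set R) :
  measurable_fun D (fun t : R => `|t|^-1).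
Proof.
rewrite (_ : (fun _ => _) = (fun t : R => `|t| `^ -1)); last first.
  by apply/funext => t; rewrite powR_inv1.
apply: (@measurableT_comp _ _ _ _ _ _ (fun x : R => x `^ -1)).
  exact: measurable_powR.
exact: normr_measurable.
Qed.

Let haar_sigma_additive : semi_sigma_additive haar.
Proof.
move=> A mA tA mUA; rewrite /haar ge0_integral_bigcup//=; last first.
  by apply/measurable_EFinP; exact: measurable_norm_inv.
apply: is_cvg_ereal_nneg_natsum_cond => n _ _.
by apply: integral_ge0 => x _; rewrite lee_fin invr_ge0.
Qed.

HB.instance Definition _ := isMeasure.Build _ _ _ haar
  haar0 haar_ge0 haar_sigma_additive.

End HaarMeasure.


Local Notation Re := complex.Re.
Local Notation Im := complex.Im.

Section L2.
Context (R : realType).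
Local Notation mu := (@haar R).

(* f is in L^2 iff Re f and Im f are measurable with finite L^2 norm. *)
Definition sqint : {pred R -> R[i]} := fun f =>
  (((fun t => Re (f t)) : R -> R) \in Lfun mu 2%:E) &&
  (((fun t => Im (f t)) : R -> R) \in Lfun mu 2%:E).

Let le12 : (1 <= 2%:E :> \bar R)%E.
Proof. by rewrite lee_fin ler1n. Qed.

Let LfunD (f g : R -> R) : f \in Lfun mu 2%:E -> g \in Lfun mu 2%:E ->
  f \+ g \in Lfun mu 2%:E.
Proof. by move=> lf lg; apply: (Lfun_addr_closed mu le12).2. Qed.

Let LfunZ (a : R) (f : R -> R) : f \in Lfun mu 2%:E ->
  (fun t => a * f t) \in Lfun mu 2%:E.
Proof.
move=> lf; have [L0 L] := Lfun_submod_closed mu le12.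
by have := L a f 0 lf L0; rewrite addr0.
Qed.

Lemma sqint_submod_closed : submod_closed sqint.
Proof.
split.
  have L0 : (fun=> 0 : R) \in Lfun mu 2%:E.
    exact: (Lfun_submod_closed mu le12).1.
  by apply/andP; split.
move=> a f g /andP[f1 f2] /andP[g1 g2]; apply/andP; split.
- rewrite [X in X \in _](_ : _ = (fun t => Re a * Re (f t)) \+
     (fun t => - Im a * Im (f t)) \+ (fun t => Re (g t))); last first.
    apply/funext => t /=.
    rewrite /GRing.add/= /GRing.scale/=.
    by case: a (f t) (g t) => [a b] [c d] [e k] /=; rewrite mulNr.
  by do !apply: LfunD => //; exact: LfunZ.
- rewrite [X in X \in _](_ : _ = (fun t => Re a * Im (f t)) \+
     (fun t => Im a * Re (f t)) \+ (fun t => Im (g t))); last first.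
    apply/funext => t /=.
    rewrite /GRing.add/= /GRing.scale/=.
    by case: a (f t) (g t) => [a b] [c d] [e k] /=.
  by do !apply: LfunD => //; exact: LfunZ.
Qed.

HB.instance Definition _ :=
  GRing.isSubmodClosed.Build _ _ sqint sqint_submod_closed.

Record sqintfun := MkSqintfun { sqint_val :> R -> R[i]; _ : sqint_val \in sqint }.
HB.instance Definition _ := [isSub for sqint_val].
HB.instance Definition _ := [Choice of sqintfun by <:].
HB.instance Definition _ := [SubChoice_isSubLmodule of sqintfun by <:].

Lemma sqint_valP (f : sqintfun) : sqint f.
Proof. by case: f. Qed.

Lemma sqintfunZ a (f : sqintfun) t : (a *: f) t = a * f t.
Proof. by []. Qed.

Lemma sqintfunB (f g : sqintfun) t : (f - g) t = f t - g t.
Proof. by []. Qed.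

Definition ae0 : {pred sqintfun} :=
  fun f => `[< {ae mu, forall t, f t = 0} >].

Let haar_ae : Filter (almost_everywhere mu).
Proof. exact: ae_filter_ringOfSetsType. Qed.

Lemma ae0P (f : sqintfun) : reflect {ae mu, forall t, f t = 0} (f \in ae0).
Proof. exact: asboolP. Qed.

Lemma ae0Z a (f : sqintfun) : f \in ae0 -> a *: f \in ae0.
Proof.
move=> /ae0P f0; apply/ae0P; apply: (@filterS _ _ haar_ae _ _ _ f0) => t ft.
by rewrite sqintfunZ (ft : f t = 0) mulr0.
Qed.

Lemma ae0_zmod_closed : zmod_closed ae0.
Proof.
split; first by apply/ae0P; apply: aeW.
move=> f g /ae0P f0 /ae0P g0; apply/ae0P; apply: (@filterS2 _ _ haar_ae _ _ _ _ f0 g0) => t ft gt.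
by rewrite sqintfunB (ft : f t = 0) (gt : g t = 0) subrr.
Qed.
HB.instance Definition _ := GRing.isZmodClosed.Build _ ae0 ae0_zmod_closed.

Local Open Scope quotient_scope.

(* H = L^2(R^x, dt/|t|): square-integrable functions modulo null functions. *)
Definition L2 : Type := Quotient.quot ae0.
HB.instance Definition _ := Choice.on L2.
HB.instance Definition _ := GRing.Zmodule.on L2.
HB.instance Definition _ := EqQuotient.on L2.

Definition L2scale (a : R[i]) (x : L2) : L2 := \pi_L2 (a *: repr x).

Lemma L2_piE (f g : sqintfun) : (\pi_L2 f = \pi_L2 g) <-> (f - g \in ae0).
Proof.
have := Quotient.idealrBE ae0 f g; rewrite /L2 => H.
by rewrite H; split => [/eqP//|/eqP//].
Qed.

Lemma L2_piD (f g : sqintfun) : \pi_L2 (f + g) = \pi_L2 f + \pi_L2 g.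
Proof. exact: (Quotient.pi_add ae0). Qed.

Lemma L2_piZ a (f : sqintfun) : \pi_L2 (a *: f) = L2scale a (\pi_L2 f).
Proof.
apply/L2_piE; rewrite -scalerBr; apply: ae0Z; apply/L2_piE.
by rewrite reprK.
Qed.

Let scaleA a b x : L2scale a (L2scale b x) = L2scale (a * b) x.
Proof. elim/quotW: x => f.
by rewrite -(L2_piZ b f) -(L2_piZ a (b *: f)) -(L2_piZ (a * b) f) scalerA. Qed.

Let scale1 : left_id 1 L2scale.
Proof. by elim/quotW => f; rewrite -L2_piZ scale1r. Qed.

Let scaleDr : right_distributive L2scale +%R.
Proof.
move=> a; elim/quotW => f; elim/quotW => g.
by rewrite -L2_piD -!L2_piZ scalerDr L2_piD.
Qed.

Let scaleDl x : {morph L2scale^~ x : a b / a + b}.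
Proof. by elim/quotW: x => f a b; rewrite -!L2_piZ scalerDl L2_piD. Qed.

HB.instance Definition _ := GRing.Zmodule_isLmodule.Build R[i] L2
  scaleA scale1 scaleDr scaleDl.

(* An arbitrary representative of the class x. *)
Definition L2fun (x : L2) : R -> R[i] := repr x.
Coercion L2fun : L2 >-> Funclass.

(* The class of f if f is square-integrable, and 0 otherwise. *)
Definition toL2 (f : R -> R[i]) : L2 := \pi_L2 (insubd (0 : sqintfun) f).

Lemma toL2E (f : R -> R[i]) : sqint f -> {ae mu, forall t, toL2 f t = f t}.
Proof.
move=> sf.
have /L2_piE/ae0P H : \pi_L2 (repr (toL2 f)) = \pi_L2 (insubd (0 : sqintfun) f).
  by rewrite reprK.
apply: (@filterS _ _ haar_ae _ _ _ H) => t /= /eqP.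
rewrite -[X in X == _]/(toL2 f t - val (insubd (0 : sqintfun) f) t).
by rewrite insubdK// subr_eq0 => /eqP.
Qed.

Lemma L2fun_sqint (x : L2) : sqint x.
Proof. exact: sqint_valP. Qed.

Lemma L2_funP (x y : L2) : {ae mu, forall t, x t = y t} -> x = y.
Proof.
move=> H; rewrite -[x]reprK -[y]reprK; apply/L2_piE/ae0P.
apply: (@filterS _ _ haar_ae _ _ _ H) => t xy.
by rewrite sqintfunB; apply/eqP; rewrite subr_eq0; apply/eqP.
Qed.

Lemma L2funD (x y : L2) : {ae mu, forall t, L2fun (x + y) t = x t + y t}.
Proof.
have /L2_piE/ae0P H : \pi_L2 (repr (x + y)) = \pi_L2 (repr x + repr y).
  by rewrite L2_piD !reprK.
apply: (@filterS _ _ haar_ae _ _ _ H) => t /eqP.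
by rewrite sqintfunB subr_eq0 => /eqP.
Qed.

Lemma L2funZ a (x : L2) : {ae mu, forall t, L2fun (a *: x) t = a * x t}.
Proof.
have /L2_piE/ae0P H : \pi_L2 (repr (a *: x)) = \pi_L2 (a *: repr x).
  by rewrite reprK.
apply: (@filterS _ _ haar_ae _ _ _ H) => t /eqP.
by rewrite sqintfunB subr_eq0 => /eqP.
Qed.

(* Inner product, linear in the first variable. *)
Definition L2dot (x y : L2) : R[i] :=
  Complex (\int[mu]_t Re (x t * conjc (y t))) (\int[mu]_t Im (x t * conjc (y t))).

Definition L2norm (x : L2) : R :=
  fine ('N[mu]_2%:E[EFin \o (fun t => Normc.normc (x t))])%E.

Let N (u : R -> R) := ('N[mu]_2%:E[EFin \o u])%E.

Let sqint_measurable_normc (f : R -> R[i]) : sqint f ->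
  measurable_fun [set: R] (fun t => Normc.normc (f t)).
Proof.
move=> /andP[/andP[/set_mem/= m1 _] /andP[/set_mem/= m2 _]].
rewrite (_ : (fun _ => _) =
  (fun t : R => (Re (f t) ^+ 2 + Im (f t) ^+ 2) `^ 2^-1)); last first.
  apply/funext => t; rewrite powR12_sqrt ?addr_ge0 ?sqr_ge0//.
  by case: (f t).
apply: (@measurableT_comp _ _ _ _ _ _ (fun x : R => x `^ 2^-1)).
  exact: measurable_powR.
by apply: measurable_funD; exact: measurable_funX.
Qed.

Let N_le (u v : R -> R) :
  measurable_fun [set: R] u -> measurable_fun [set: R] v ->
  (forall t, 0 <= u t) -> (forall t, 0 <= v t) ->
  {ae mu, forall t, u t <= v t} -> (N u <= N v)%E.
Proof.
move=> mu_ mv u0 v0 uv; rewrite /N unlock.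
have mp (w : R -> R) : measurable_fun [set: R] w ->
    measurable_fun [set: R] (fun t => (`|(EFin \o w) t| `^ 2)%E).
  move=> mw; apply/(measurable_EFinP _ (fun t => `|w t| `^ 2)).
  apply: (@measurableT_comp _ _ _ _ _ _ (fun x : R => x `^ 2)).
    exact: measurable_powR.
  by apply: measurableT_comp.
apply: gt0_ler_poweR; rewrite ?invr_ge0//.
- by rewrite in_itv/= leey andbT; apply: integral_ge0 => t _; rewrite lee_fin powR_ge0.
- by rewrite in_itv/= leey andbT; apply: integral_ge0 => t _; rewrite lee_fin powR_ge0.
apply: ae_ge0_le_integral => //.
- by move=> t _; exact: poweR_ge0.
- exact: mp.
- by move=> t _; exact: poweR_ge0.
- exact: mp.
apply: (@filterS _ _ haar_ae _ _ _ uv) => t /= uvt _.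
by rewrite lee_fin ge0_ler_powR// ?nnegrE// !ger0_norm.
Qed.

Lemma L2norm_ge0 (x : L2) : 0 <= L2norm x.
Proof. by rewrite fine_ge0// Lnorm_ge0. Qed.

Let N_fin (f : R -> R[i]) : sqint f ->
  N (fun t => Normc.normc (f t)) \is a fin_num.
Proof.
move=> sf; have mf := sqint_measurable_normc sf.
move: sf => /andP[/andP[/set_mem/= m1 /set_mem/= f1]].
move=> /andP[/set_mem/= m2 /set_mem/= f2].
have n1 : measurable_fun [set: R] (fun t => `|Re (f t)|).
  exact: measurableT_comp.
have n2 : measurable_fun [set: R] (fun t => `|Im (f t)|).
  exact: measurableT_comp.
rewrite ge0_fin_numE ?Lnorm_ge0//.
apply: (@le_lt_trans _ _ (N ((fun t => `|Re (f t)|) \+ (fun t => `|Im (f t)|)))).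
  apply: N_le => //.
  - exact: measurable_funD.
  - by move=> t; rewrite /Normc.normc; case: (f t) => a b; rewrite sqrtr_ge0.
  - by move=> t /=; rewrite addr_ge0.
  - apply: aeW => t /=; case: (f t) => a b /=.
    rewrite -[leRHS]ger0_norm ?addr_ge0// -sqrtr_sqr ler_wsqrtr//.
    by rewrite sqrrD !real_normK ?num_real// lerD2r lerDl mulrn_wge0// mulr_ge0.
apply: le_lt_trans (minkowski_EFin mu n1 n2 _) _; first by rewrite ler1n.
have E (w : R -> R) : N (fun t => `|w t|) = N w by rewrite /N -[RHS]Lnorm_abse.
by rewrite -/(N _) -/(N _) !E lte_add_pinfty.
Qed.

Lemma L2normD (x y : L2) : L2norm (x + y) <= L2norm x + L2norm y.
Proof.
have fx := N_fin (L2fun_sqint x); have fy := N_fin (L2fun_sqint y).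
have mx := sqint_measurable_normc (L2fun_sqint x).
have my := sqint_measurable_normc (L2fun_sqint y).
have n0 (z : L2) t : 0 <= Normc.normc (z t).
  by rewrite /Normc.normc; case: (z t) => a b; exact: sqrtr_ge0.
rewrite /L2norm -fineD//; apply: fine_le; rewrite ?fin_numD ?fx ?fy//.
  exact: N_fin (L2fun_sqint _).
apply: le_trans (minkowski_EFin mu mx my _); last by rewrite ler1n.
apply: N_le => //.
- exact: sqint_measurable_normc (L2fun_sqint _).
- exact: measurable_funD.
- by move=> t /=; rewrite addr_ge0.
- apply: (@filterS _ _ haar_ae _ _ _ (L2funD x y)) => t /= ->.
  exact: le_normcD.
Qed.

Lemma L2normZ a (x : L2) : L2norm (a *: x) = Normc.normc a * L2norm x.
Proof.
have fx := N_fin (L2fun_sqint x).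
have mx := sqint_measurable_normc (L2fun_sqint x).
have n0 (z : R[i]) : 0 <= Normc.normc z.
  by rewrite /Normc.normc; case: z => c d; exact: sqrtr_ge0.
pose u : R -> R := fun t => Normc.normc (x t).
have Lu : u \in Lfun mu 2%:E.
  apply/andP; split; apply/mem_set => //=.
  by move: fx; rewrite ge0_fin_numE ?Lnorm_ge0.
have E : N (fun t => Normc.normc a * u t) = ((Normc.normc a)%:E * N u)%E.
  have := LnormZ (Lfun_Sub le12 Lu) (Normc.normc a).
  by rewrite ger0_norm.
have -> : Normc.normc a * L2norm x = fine ((Normc.normc a)%:E * N u)%E.
  by rewrite fineM.
rewrite -E /L2norm; congr fine; apply/eqP; rewrite eq_le.
have ma : measurable_fun [set: R] (fun t => Normc.normc a * u t).
  exact: measurable_funM.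
have max : measurable_fun [set: R] (fun t => Normc.normc (L2fun (a *: x) t)).
  exact: sqint_measurable_normc (L2fun_sqint _).
have au0 t : 0 <= Normc.normc a * u t by exact: (mulr_ge0 (n0 a) (n0 (x t))).
apply/andP; split; apply: N_le => //;
  by apply: (@filterS _ _ haar_ae _ _ _ (L2funZ a x)) => t /= ->;
     rewrite Normc.normcM.
Qed.

End L2.

Section TraceClass.
Context (R : realType).
Local Notation H := (L2 R).

(* T = \sum_n u_n (x) v_n with \sum_n |u_n| |v_n| < oo, where u (x) v is the
   operator x |-> <x, v> u; such a T is automatically linear and bounded. *)
Definition nuclear_rep (T : H -> H) (u v : nat -> H) : Prop :=
  cvgn (series (fun n => L2norm (u n) * L2norm (v n))) /\
  forall x : H,
    L2norm (T x - \sum_(0 <= n < N) L2dot x (v n) *: u n) @[N --> \oo] --> (0 : R).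

Definition nuclear : {pred H -> H} :=
  fun T => `[< exists u v, nuclear_rep T u v >].

Lemma L2norm0 : L2norm (0 : H) = 0.
Proof. by rewrite -(scale0r (0 : H)) L2normZ Normc.normc0 mul0r. Qed.

Let interleave (A : Type) (a b : nat -> A) : nat -> A :=
  fun n => if odd n then b n./2 else a n./2.

Let sum_interleave (V : zmodType) (a b : nat -> V) N :
  \sum_(0 <= n < N) interleave a b n =
  \sum_(0 <= n < uphalf N) a n + \sum_(0 <= n < N./2) b n.
Proof.
elim: N => [|N IH]; first by rewrite !big_geq// addr0.
rewrite big_nat_recr//= {}IH /interleave uphalf_half.
case: (odd N) => /=.
- by rewrite add1n -addrA -(big_nat_recr _ _ b).
- by rewrite add0n addrAC -(big_nat_recr _ _ a).
Qed.

Let cvg_half : (fun n => n./2) @ \oo --> \oo.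
Proof.
apply/cvgnyPge => A; exists A.*2 => // n /= An.
by rewrite geq_half_double.
Qed.

Let cvg_uphalf : (fun n => uphalf n) @ \oo --> \oo.
Proof.
apply/cvgnyPge => A; exists A.*2 => // n /= An.
by rewrite uphalf_half (leq_trans _ (leq_addl _ _))// geq_half_double.
Qed.

Lemma nuclear_submod_closed : submod_closed nuclear.
Proof.
split.
  apply/asboolP; exists (fun=> 0), (fun=> 0); split.
    rewrite (_ : series _ = fun=> 0); first exact: is_cvg_cst.
    by apply/funext => n; rewrite /series/= big1// => i _; rewrite L2norm0 mul0r.
  move=> x; apply: cvg_near_cst; apply: nearW => n.
  by rewrite big1 ?subr0 ?L2norm0// => i _; rewrite scaler0.
move=> a S T /asboolP[u [v [uv Suv]]] /asboolP[w [z [wz Twz]]].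
apply/asboolP.
exists (interleave (fun n => a *: u n) w), (interleave v z); split.
  rewrite (_ : series _ = fun N =>
     Normc.normc a * series (fun n => L2norm (u n) * L2norm (v n)) (uphalf N)
     + series (fun n => L2norm (w n) * L2norm (z n)) N./2); last first.
    apply/funext => N; rewrite /series/= mulr_sumr.
    rewrite -sum_interleave; apply: eq_bigr => i _.
    rewrite /interleave; case: (odd i) => //.
    by rewrite L2normZ mulrA.
  apply: is_cvgD; [apply: is_cvgMr|].
  - by apply/cvg_ex; exists (limn (series (fun n => L2norm (u n) * L2norm (v n))));
      exact: cvg_comp cvg_uphalf uv.
  - by apply/cvg_ex; exists (limn (series (fun n => L2norm (w n) * L2norm (z n))));
      exact: cvg_comp cvg_half wz.
move=> x.
pose e1 N := L2norm (S x - \sum_(0 <= n < N) L2dot x (v n) *: u n).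
pose e2 N := L2norm (T x - \sum_(0 <= n < N) L2dot x (z n) *: w n).
apply: (@squeeze_cvgr _ _ _ _ (fun=> 0)
  (fun N => Normc.normc a * e1 (uphalf N) + e2 N./2)); last 2 first.
- exact: cvg_cst.
- rewrite -[X in _ --> X]addr0 -[X in _ --> X + _](mulr0 (Normc.normc a)).
  apply: cvgD; first (apply: cvgMr).
    exact: cvg_comp cvg_uphalf (Suv x).
  exact: cvg_comp cvg_half (Twz x).
apply: nearW => N; rewrite L2norm_ge0/=.
rewrite -L2normZ; apply: le_trans (L2normD _ _); rewrite le_eqVlt.
apply/orP; left; apply/eqP; congr L2norm.
rewrite (eq_bigr (interleave (fun n => a *: (L2dot x (v n) *: u n))
   (fun n => L2dot x (z n) *: w n))); last first.
  by move=> i _; rewrite /interleave; case: (odd i) => //; rewrite !scalerA mulrC.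
rewrite sum_interleave opprD addrACA; congr (_ + _).
by rewrite scalerBr scaler_sumr.
Qed.

HB.instance Definition _ :=
  GRing.isSubmodClosed.Build _ _ nuclear nuclear_submod_closed.

(* The projective tensor product of H and its conjugate, realised as the
   trace-class operators S_1(H): every element of the former is an absolutely
   convergent series of elementary tensors, and its projective norm, which is
   the trace norm, is the infimum of \sum_n |u_n| |v_n| over these series. *)
Record traceclass :=
  MkTraceclass { tc_val :> H -> H; tc_valP : tc_val \in nuclear }.
HB.instance Definition _ := [isSub for tc_val].
HB.instance Definition _ := [Choice of traceclass by <:].
HB.instance Definition _ := [SubChoice_isSubLmodule of traceclass by <:].

Definition tcnorm (T : traceclass) : R :=
  inf [set r | exists u v, nuclear_rep T u v /\
         r = limn (series (fun n => L2norm (u n) * L2norm (v n)))].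

Lemma rank1_nuclear (x y : H) : (fun z => L2dot z y *: x) \in nuclear.
Proof.
apply/asboolP.
exists (fun n => if n == 0%N then x else 0), (fun n => if n == 0%N then y else 0).
split.
  apply/cvg_ex; exists (L2norm x * L2norm y); apply: cvg_near_cst.
  near=> n; have n0 : (0 < n)%N by near: n; exact: nbhs_infty_gt.
  rewrite /series/= big_ltn//= big_nat big1 ?addr0// => i /andP[i0 _].
  by rewrite gtn_eqF// L2norm0 mul0r.
move=> z; apply: cvg_near_cst.
near=> n; have n0 : (0 < n)%N by near: n; exact: nbhs_infty_gt.
rewrite big_ltn//= big_nat big1 ?addr0 ?subrr ?L2norm0// => i /andP[i0 _].
by rewrite gtn_eqF// scaler0.
Unshelve. all: by end_near. Qed.

(* The elementary tensor x (x) y. *)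
Definition rank1 (x y : H) : traceclass := MkTraceclass (rank1_nuclear x y).

End TraceClass.

Section Bochner.
Context d (X : measurableType d) (R : realType) (mu : {measure set X -> \bar R}).
Context (E : lmodType R[i]) (nrm : E -> R).

(* A simple function is given by a list of (measurable set, value) pairs; the
   sets need not be disjoint. *)
Definition step (s : seq (set X * E)) (x : X) : E :=
  \sum_(p <- s) (\1_(p.1) x)%:C *: p.2.

Definition step_integral (s : seq (set X * E)) : E :=
  \sum_(p <- s) (fine (mu p.1))%:C *: p.2.

(* f is Bochner integrable with integral I: f is the a.e. limit of integrable
   simple functions s_n (strong measurability), \int |f - s_n| -> 0, and
   I = lim \int s_n. *)
Definition is_bochner_integral (f : X -> E) (I : E) : Prop :=
  exists s : nat -> seq (set X * E),
    [/\ forall n, {in s n, forall p, measurable p.1 /\ (mu p.1 < +oo)%E},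
        {ae mu, forall x, nrm (f x - step (s n) x) @[n --> \oo] --> (0 : R)},
        (\int[mu]_x (nrm (f x - step (s n) x))%:E)%E @[n --> \oo] --> 0%E &
        nrm (I - step_integral (s n)) @[n --> \oo] --> (0 : R)].

End Bochner.

Section DualConvolution.
Context (R : realType).
Local Notation H := (L2 R).

(* lambda(r), for r != 0: dilations preserve the Haar measure, so the class does
   not depend on the representative. *)
Definition dilate (r : R) (x : H) : H := toL2 (fun t => x (r^-1 * t)).

(* Pointwise product.  It may fail to be square-integrable, and is then 0 by
   convention; in the integral below, by Fubini, this happens only for h in a
   null set. *)
Definition L2mul (x y : H) : H := toL2 (fun t => x t * y t).

(* The unique contractive bilinear map on S_1(H) with the given values, as
   Bochner integrals in S_1(H), on pairs of elementary tensors. *)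
Definition is_dual_convolution
    (B : traceclass R -> traceclass R -> traceclass R) : Prop :=
  [/\ forall T, linear (B T), forall T, linear (B^~ T),
      forall S T, tcnorm (B S T) <= tcnorm S * tcnorm T &
      forall x y x' y' : H,
        is_bochner_integral (@haar R) (@tcnorm R)
          (fun h => rank1 (L2mul (dilate (1 + h) x) (dilate (1 + h^-1) x'))
                          (L2mul (dilate (1 + h) y) (dilate (1 + h^-1) y')))
          (B (rank1 x y) (rank1 x' y'))].

Definition Hplus : set H := [set x | {ae @haar R, forall t, t < 0 -> x t = 0}].
Definition Hminus : set H := [set x | {ae @haar R, forall t, 0 < t -> x t = 0}].

(* The z in K with x - z orthogonal to K (unique when K is a closed subspace). *)
Definition orth_proj (K : set H) (x : H) : H :=
  xget 0 [set z | K z /\ forall k, K k -> L2dot (x - z) k = 0].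

Definition Pplus : H -> H := orth_proj Hplus.
Definition Pminus : H -> H := orth_proj Hminus.

Definition is_Pdiag (P : traceclass R -> traceclass R) : Prop :=
  [/\ linear P,
      exists M, forall T, tcnorm (P T) <= M * tcnorm T &
      forall x y, P (rank1 x y) =
        rank1 (Pplus x) (Pplus y) + rank1 (Pminus x) (Pminus y)].

End DualConvolution.

(* Main.v *)
Require Import Defs.
From HB Require Import structures.
From mathcomp Require Import all_boot all_order all_algebra.
From mathcomp Require Import complex.
From mathcomp Require Import all_classical all_reals all_analysis.
From mathcomp Require Import measurable_realfun ring.

(** The dual convolution of two elementary tensors is the integral over [h] of the
    tensors of products [lambda(1+h) x . lambda(1+h^-1) x'].  Dilation by a positive
    number preserves each half-line, dilation by a negative number exchanges them.
    Hence, for a fixed [h] other than 0 and -1, replacing [x] and [x'] by their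
    restrictions to half-lines of signs [b] and [c] turns the product into its
    restriction to one half-line when the dilated half-lines agree, and into 0
    otherwise ([dilprod_proj]).  Of the four terms obtained by expanding
    the dual convolution of [Pdiag (x (x) y)] and [Pdiag (x' (x) y')], exactly two
    survive at each [h], and they are the two blocks of [Pdiag] applied to the
    integrand ([rank1_dilprod_proj]): the two block-diagonal integrands
    agree at almost every [h].

    Three analytic facts turn this remark into a proof.

    - The pointwise products are square-integrable for almost every [h]
      ([ae_sqint_product]).  This matters because [L2mul] is 0 by convention on
      other pairs, and this convention does not commute with restriction.  It
      follows from Tonelli's theorem and the dilation invariance of the Haar
      measure.

    - Bochner integrals are evaluated weakly.  The real functionals
      [T |-> Re <T z, w>] are bounded for the trace norm and separate trace-class
      operators ([matrix_coef_le], [traceclass_ext]); each of them, and its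
      composition with the bounded map [Pdiag], passes under the integral sign
      ([bochner_weak]).  The identity on elementary tensors thereby becomes an
      equality of scalar Lebesgue integrals
      ([Pdiag_dual_convolution_rank1]).

    - Elementary tensors are total: the tails of a nuclear series tend to 0 in trace
      norm, so bounded additive functionals that vanish on elementary tensors are 0
      ([tc_functional_eq0]).  Applying this to each variable of the difference of
      the two sides gives the general case. *)

Set Implicit Arguments.
Unset Strict Implicit.
Unset Printing Implicit Defensive.
Import Order.TTheory GRing.Theory Num.Theory.
Import numFieldNormedType.Exports.
Local Open Scope classical_set_scope.
Local Open Scope ring_scope.
Local Open Scope complex_scope.

Local Notation Re := complex.Re.
Local Notation Im := complex.Im.

(** * Weak evaluation of Bochner integrals *)
Section LowerIntegral.
Context d (X : measurableType d) (R : realType) (mu : {measure set X -> \bar R}).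
Local Open Scope ereal_scope.

(** Monotonicity without measurability of the larger function: the integral of a
    non-negative function is by definition a supremum over the simple functions
    below it, so larger functions have larger sets of competitors.  This is what
    the real functions [h |-> nrm (f h - s_n h)] require, because nothing makes
    [nrm] measurable. *)
Lemma le_lower_integral (f g : X -> \bar R) :
  (forall x, 0 <= f x) -> (forall x, f x <= g x) ->
  \int[mu]_x f x <= \int[mu]_x g x.
Proof.
move=> f0 fg; have g0 x : 0 <= g x := le_trans (f0 x) (fg x).
rewrite !ge0_integralTE//; apply: ereal_sup_le => _ [h hf <-].
by exists h => // x; exact: le_trans (hf x) (fg x).
Qed.

Lemma ae_le_lower_integral (f g : X -> \bar R) :
  measurable_fun setT f -> (forall x, 0 <= f x) -> (forall x, 0 <= g x) ->
  {ae mu, forall x, f x <= g x} -> \int[mu]_x f x <= \int[mu]_x g x.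
Proof.
move=> mf f0 g0 [N [mN N0 fgN]].
have -> : \int[mu]_x f x = \int[mu]_x (f \_ (~` N)) x.
  apply: ae_eq_integral => //.
    by apply/(measurable_restrictT _ _).1; [exact: measurableC|exact: measurable_funS mf].
  exists N; split=> // x /= h; apply: contrapT => Nx; apply: h => _.
  by rewrite patchE mem_set.
apply: le_lower_integral => x; rewrite patchE; case: ifPn => //.
rewrite inE => Nx; apply: contrapT => h; exact: Nx (fgN _ h).
Qed.

End LowerIntegral.

Section WeakBochner.
Context d (X : measurableType d) (R : realType) (mu : {measure set X -> \bar R}).
Context (E : lmodType R[i]) (nrm : E -> R) (psi : E -> R) (C : R).
Hypothesis nrm_ge0 : forall v, 0 <= nrm v.
Hypothesis psiD : forall u v, psi (u + v) = psi u + psi v.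
Hypothesis psiZ : forall (r : R) v, psi (r%:C *: v) = r * psi v.
Hypothesis C0 : 0 < C.
Hypothesis psi_le : forall v, `|psi v| <= C * nrm v.

Let psi0 : psi 0 = 0.
Proof. by have := psiZ 0 0; rewrite scale0r mul0r. Qed.

Let psiB u v : psi (u - v) = psi u - psi v.
Proof.
by apply/eqP; rewrite eq_sym subr_eq -psiD subrK.
Qed.

Let psi_sum (I : Type) (s : seq I) (F : I -> E) :
  psi (\sum_(i <- s) F i) = \sum_(i <- s) psi (F i).
Proof. by apply: (big_morph psi psiD psi0). Qed.

Let psi_stepE (s : seq (set X * E)) (x : X) :
  psi (step s x) = \sum_(p <- s) psi p.2 * \1_(p.1) x.
Proof.
by rewrite psi_sum; apply: eq_bigr => p _; rewrite psiZ mulrC.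
Qed.

Let psi_step (s : seq (set X * E)) :
  {in s, forall p, measurable p.1 /\ (mu p.1 < +oo)%E} ->
  mu.-integrable setT (EFin \o (fun x => psi (step s x))) /\
  (\int[mu]_x (psi (step s x))%:E = (psi (step_integral mu s))%:E)%E.
Proof.
rewrite (_ : (fun x => _) = (fun x => \sum_(p <- s) psi p.2 * \1_(p.1) x));
  last by apply/funext => x; exact: psi_stepE.
under eq_integral do rewrite psi_stepE.
rewrite /step_integral psi_sum.
elim: s => [|p s IH] H.
  split.
    by under [X in _.-integrable _ (_ \o X)]eq_fun do rewrite big_nil; exact: integrable0.
  by under eq_integral do rewrite big_nil; rewrite integral0 big_nil.
have [|is_ es] := IH; first by move=> q qs; apply: H; rewrite inE qs orbT.
have [mp pfin] := H p (mem_head _ _).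
have i1 : mu.-integrable setT (EFin \o \1_(p.1)).
  apply/integrableP; split; first by apply/measurable_EFinP; exact: measurable_indic.
  under eq_integral do rewrite /= ger0_norm//.
  by rewrite integral_indic// setIT.
have ip : mu.-integrable setT (EFin \o (fun x => psi p.2 * \1_(p.1) x)).
  apply: (integrableZl measurableT (psi p.2) i1).
have dec : (fun x => \sum_(q <- p :: s) psi q.2 * \1_(q.1) x) =
   (fun x => psi p.2 * \1_(p.1) x + \sum_(q <- s) psi q.2 * \1_(q.1) x).
  by apply/funext => x; rewrite big_cons.
rewrite dec; split.
  exact: (integrableD measurableT ip is_).
under eq_integral do rewrite big_cons EFinD.
rewrite (integralD measurableT ip is_) es big_cons EFinD; congr (_ + _)%E.
rewrite psiZ (integralZl measurableT i1 (psi p.2)).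
by rewrite integral_indic// setIT mulrC EFinM fineK// ge0_fin_numE.
Qed.

(** A bounded real-linear functional [psi] passes under a Bochner integral.  The
    scalar functions [psi (s_n x)] are measurable, converge a.e. to
    [psi (f x)], and have integral [psi (step_integral (s_n))] by linearity; the
    bound on [psi] turns the convergence of the simple functions [s_n] to [f] into
    convergence in L^1 of these scalar functions.  Since [psi \o f] is only a.e.
    equal to a measurable function, the conclusion is about such a function
    [g]. *)
Lemma bochner_weak (f : X -> E) (I : E) : is_bochner_integral mu nrm f I ->
  exists g : X -> R, [/\ mu.-integrable setT (EFin \o g),
    {ae mu, forall x, psi (f x) = g x} &
    (\int[mu]_x (g x)%:E = (psi I)%:E)%E].
Proof.
move=> [s [sP sf sint sI]].
pose h n x := psi (step (s n) x).
have hi n : mu.-integrable setT (EFin \o h n) := (psi_step (sP n)).1.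
have hI n : (\int[mu]_x (h n x)%:E = (psi (step_integral mu (s n)))%:E)%E :=
  (psi_step (sP n)).2.
have mh n : measurable_fun setT (h n).
  by apply/measurable_EFinP; exact: measurable_int (hi n).
(* A limsup is measurable without knowing where the sequence converges, and it is
   the limit at almost every point. *)
pose g x := fine (limn_esup (fun n => (h n x)%:E)).
have mg : measurable_fun setT g.
  apply: measurableT_comp => //.
  by apply: measurable_fun_limn_esup => n; apply/measurable_EFinP; exact: mh.
have ae_filter : Filter (almost_everywhere mu) by exact: ae_filter_ringOfSetsType.
have fg : {ae mu, forall x, psi (f x) = g x}.
  apply: (@filterS _ _ ae_filter _ _ _ sf) => x sfx.
  have hx : h n x @[n --> \oo] --> psi (f x).
    apply/cvgrPdist_lt => e e0.
    have Ce : 0 < C^-1 * e by rewrite mulr_gt0 ?invr_gt0.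
    move/cvgrPdist_lt: sfx => /(_ _ Ce); apply: filterS => n /=.
    rewrite sub0r normrN ger0_norm// ltr_pdivlMl// => ne.
    rewrite /h -psiB. apply: (le_lt_trans (psi_le _)). exact: ne.
  have hEx : (h n x)%:E @[n --> \oo] --> (psi (f x))%:E.
    by apply: cvg_EFin; [exact: nearW|exact: hx].
  by rewrite /g (cvg_limn_einf_sup hEx).
have mgh n : measurable_fun setT (fun x => (`|g x - h n x|)%:E).
  by apply/measurable_EFinP; apply: measurableT_comp => //; exact: measurable_funB.
have le_gh n : (\int[mu]_x (`|g x - h n x|)%:E <=
    C%:E * \int[mu]_x (nrm (f x - step (s n) x))%:E)%E.
  rewrite -lee_pdivrMl// -ge0_integralZl//; last by rewrite lee_fin invr_ge0 ltW.
  apply: ae_le_lower_integral => //.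
  - by apply: measurable_funeM.
  - by move=> x; rewrite mule_ge0// lee_fin// invr_ge0 ltW.
  - by move=> x; rewrite lee_fin.
  apply: (@filterS _ _ ae_filter _ _ _ fg) => x <-.
  by rewrite /h -psiB -EFinM lee_fin ler_pdivrMl.
have gh0 : (\int[mu]_x (`|g x - h n x|)%:E)%E @[n --> \oo] --> 0%E.
  apply: (@squeeze_cvge _ _ _ _ (fun=> 0%E) _
    (fun n => C%:E * \int[mu]_x (nrm (f x - step (s n) x))%:E)%E).
  - apply: nearW => k; rewrite le_gh andbT.
    by apply: integral_ge0 => x _; rewrite lee_fin.
  - exact: cvg_cst.
  - by rewrite -(mule0 C%:E); apply: cvgeZl.
have /fine_cvgP[ghfin gh0'] := gh0.
have ghi : \forall n \near \oo, mu.-integrable setT (EFin \o (fun x => g x - h n x)).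
  apply: filterS ghfin => n; rewrite ge0_fin_numE ?integral_ge0// => ltn.
  apply/integrableP; split.
    by apply/measurable_EFinP; exact: measurable_funB.
  exact: ltn.
have [n0 gh_n0] := @filter_ex _ _ _ _ ghi.
have gi : mu.-integrable setT (EFin \o g).
  rewrite (_ : g = fun x => (g x - h n0 x) + h n0 x); last first.
    by apply/funext => x; rewrite subrK.
  exact: (integrableD measurableT gh_n0 (hi n0)).
exists g; split=> //.
have gfin : (\int[mu]_x (g x)%:E)%E \is a fin_num by exact: integrable_fin_num gi.
rewrite -(fineK gfin); congr EFin; set J := fine _.
have lim1 : `|J - psi (step_integral mu (s n))| @[n --> \oo] --> (0 : R).
  apply: (@squeeze_cvgr _ _ _ _ (fun=> 0) _); last 2 first.
  - exact: cvg_cst.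
  - exact: gh0'.
  apply: filterS ghi => n ghn; rewrite normr_ge0/=.
  have : (`|\int[mu]_x (g x - h n x)%:E| <= \int[mu]_x (`|g x - h n x|)%:E)%E.
    apply: (@le_abse_integral _ _ _ mu setT (fun x => (g x - h n x)%:E)) => //.
    exact: measurable_int ghn.
  have -> : (\int[mu]_x (g x - h n x)%:E)%E = (J - psi (step_integral mu (s n)))%:E.
    under eq_integral do rewrite EFinB.
    by rewrite (integralB measurableT gi (hi n)) hI -(fineK gfin) EFinB.
  move=> le1; rewrite -lee_fin fineK//.
  have /integrableP[_ ?] := ghn.
  by rewrite ge0_fin_numE// integral_ge0.
have lim2 : `|psi I - psi (step_integral mu (s n))| @[n --> \oo] --> (0 : R).
  apply: (@squeeze_cvgr _ _ _ _ (fun=> 0)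
    (fun n => C * nrm (I - step_integral mu (s n)))); last 2 first.
  - exact: cvg_cst.
  - by rewrite -(mulr0 C); apply: cvgMr.
  by apply: nearW => n; rewrite normr_ge0/= -psiB.
apply/eqP; rewrite -subr_eq0 -normr_le0.
have := cvgD lim1 lim2; rewrite addr0 => lim3.
apply: (cvgr_to_ge (lim3 _)).
apply: nearW => n /=; rewrite distrC [leRHS]addrC (distrC J).
exact: ler_distD.
Qed.

End WeakBochner.

(** * The real inner product of L^2 *)
Section L2Facts.
Context (R : realType).
Local Notation mu := (@haar R).
Local Notation H := (L2 R).

#[global] Instance haar_ae_filter : Filter (almost_everywhere mu).
Proof. exact: ae_filter_ringOfSetsType. Qed.

Lemma L2fun_Re (x : H) : (fun t => Re (x t)) \in Lfun mu 2%:E.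
Proof. by have /andP[] := L2fun_sqint x. Qed.

Lemma L2fun_Im (x : H) : (fun t => Im (x t)) \in Lfun mu 2%:E.
Proof. by have /andP[] := L2fun_sqint x. Qed.

Lemma measurable_Re (x : H) : measurable_fun setT (fun t => Re (x t)).
Proof. by have /andP[/set_mem] := L2fun_Re x. Qed.

Lemma measurable_Im (x : H) : measurable_fun setT (fun t => Im (x t)).
Proof. by have /andP[/set_mem] := L2fun_Im x. Qed.

Lemma Re_mulJ (a b : R[i]) : Re (a * conjc b) = Re a * Re b + Im a * Im b.
Proof. by case: a b => [a1 a2] [b1 b2] /=; rewrite mulrN opprK. Qed.

Lemma Im_mulJ (a b : R[i]) : Im (a * conjc b) = Im a * Re b - Re a * Im b.
Proof. by case: a b => [a1 a2] [b1 b2] /=; ring. Qed.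

Lemma normc_ge0 (a : R[i]) : 0 <= Normc.normc a.
Proof. by case: a => a b; exact: sqrtr_ge0. Qed.

Lemma normc_ReIm (a : R[i]) : Normc.normc a = Num.sqrt (Re a ^+ 2 + Im a ^+ 2).
Proof. by case: a. Qed.

Lemma normc_Re (a : R[i]) : `|Re a| <= Normc.normc a.
Proof.
by rewrite normc_ReIm -sqrtr_sqr ler_wsqrtr// lerDl sqr_ge0.
Qed.

Lemma normc_Im (a : R[i]) : `|Im a| <= Normc.normc a.
Proof.
by rewrite normc_ReIm -sqrtr_sqr ler_wsqrtr// lerDr sqr_ge0.
Qed.

Lemma normc_le (a : R[i]) : Normc.normc a <= `|Re a| + `|Im a|.
Proof.
rewrite normc_ReIm -[leRHS]ger0_norm ?addr_ge0// -sqrtr_sqr ler_wsqrtr//.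
by rewrite sqrrD !real_normK ?num_real// lerD2r lerDl mulrn_wge0// mulr_ge0.
Qed.

Lemma normcJ (a : R[i]) : Normc.normc (conjc a) = Normc.normc a.
Proof. by rewrite !normc_ReIm; case: a => a b /=; rewrite sqrrN. Qed.

Lemma integrable_Re_dot (x y : H) :
  mu.-integrable setT (EFin \o (fun t => Re (x t * conjc (y t)))).
Proof.
rewrite (_ : _ \o _ = (EFin \o (fun t => Re (x t) * Re (y t))%R) \+
    (EFin \o (fun t => Im (x t) * Im (y t))%R))%E; last first.
  by apply/funext => t /=; rewrite Re_mulJ EFinD.
by apply: integrableD => //; apply/Lfun1_integrable; apply: Lfun2_mul_Lfun1;
  rewrite ?L2fun_Re ?L2fun_Im.
Qed.

Lemma integrable_Im_dot (x y : H) :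
  mu.-integrable setT (EFin \o (fun t => Im (x t * conjc (y t)))).
Proof.
rewrite (_ : _ \o _ = (EFin \o (fun t => Im (x t) * Re (y t))%R) \-
    (EFin \o (fun t => Re (x t) * Im (y t))%R))%E; last first.
  by apply/funext => t /=; rewrite Im_mulJ EFinB.
by apply: integrableB => //; apply/Lfun1_integrable; apply: Lfun2_mul_Lfun1;
  rewrite ?L2fun_Re ?L2fun_Im.
Qed.

Lemma Lfun2_integrable (u : R -> R) : measurable_fun setT u ->
  (\int[mu]_t (u t ^+ 2)%:E < +oo)%E -> u \in Lfun mu 2%:E.
Proof.
move=> mu_ fu; apply/andP; split; apply/mem_set => //=.
rewrite /finite_norm unlock; apply: poweR_lty.
apply: le_lt_trans fu; rewrite le_eqVlt; apply/orP; left; apply/eqP.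
apply: eq_integral => t _ /=.
by rewrite powR_mulrn// real_normK ?num_real.
Qed.

Definition normc2 (a : R[i]) : R := Re a ^+ 2 + Im a ^+ 2.

Lemma normc2_ge0 a : 0 <= normc2 a.
Proof. by rewrite addr_ge0 ?sqr_ge0. Qed.

Lemma normc2M a b : normc2 (a * b) = normc2 a * normc2 b.
Proof. by case: a b => [a1 a2] [b1 b2]; rewrite /normc2/=; ring. Qed.

Lemma normc_sqr (a : R[i]) : Normc.normc a ^+ 2 = normc2 a.
Proof. by rewrite normc_ReIm sqr_sqrtr// normc2_ge0. Qed.

Lemma measurable_normc2 (f : R -> R[i]) :
  measurable_fun setT (fun t => Re (f t)) ->
  measurable_fun setT (fun t => Im (f t)) ->
  measurable_fun setT (fun t => normc2 (f t)).
Proof. by move=> mr mi; apply: measurable_funD; apply: measurable_funX. Qed.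

Lemma sqintI (f : R -> R[i]) :
  measurable_fun setT (fun t => Re (f t)) ->
  measurable_fun setT (fun t => Im (f t)) ->
  (\int[mu]_t (normc2 (f t))%:E < +oo)%E -> sqint f.
Proof.
move=> mr mi ff.
have aux (u : R -> R) : measurable_fun setT u ->
    (forall t, u t ^+ 2 <= normc2 (f t)) -> u \in Lfun mu 2%:E.
  move=> mu_ ule; apply: Lfun2_integrable => //; apply: le_lt_trans ff.
  apply: ge0_le_integral => //.
  - by move=> t _; rewrite lee_fin sqr_ge0.
  - by apply/measurable_EFinP; exact: measurable_funX.
  - by apply/measurable_EFinP; exact: measurable_normc2.
  - by move=> t _; rewrite lee_fin.
by apply/andP; split; apply: aux => // t; rewrite ?lerDl ?lerDr sqr_ge0.
Qed.

Lemma L2fun_normc2_lty (x : H) : (\int[mu]_t (normc2 (x t))%:E < +oo)%E.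
Proof.
under eq_integral do rewrite EFinD.
rewrite ge0_integralD//; first last.
- by apply/measurable_EFinP; apply: measurable_funX; exact: measurable_Im.
- by move=> t _; rewrite lee_fin sqr_ge0.
- by apply/measurable_EFinP; apply: measurable_funX; exact: measurable_Re.
- by move=> t _; rewrite lee_fin sqr_ge0.
rewrite lte_add_pinfty//; rewrite -ge0_fin_numE ?integral_ge0//.
- by apply: integrable_fin_num => //; apply: Lfun2_integrable_sqr; exact: L2fun_Re.
- by move=> t _; rewrite lee_fin sqr_ge0.
- by apply: integrable_fin_num => //; apply: Lfun2_integrable_sqr; exact: L2fun_Im.
- by move=> t _; rewrite lee_fin sqr_ge0.
Qed.

Lemma measurable_normc (x : H) : measurable_fun setT (fun t => Normc.normc (x t)).
Proof.
rewrite (_ : (fun _ => _) = (fun t : R => normc2 (x t) `^ 2^-1)); last first.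
  by apply/funext => t; rewrite powR12_sqrt ?normc2_ge0// normc_ReIm.
apply: (@measurableT_comp _ _ _ _ _ _ (fun a : R => a `^ 2^-1)).
  exact: measurable_powR.
by apply: measurable_normc2; [exact: measurable_Re|exact: measurable_Im].
Qed.

Lemma L2norm_fin (x : H) :
  ('N[mu]_2%:E[EFin \o (fun t => Normc.normc (x t))])%E \is a fin_num.
Proof.
have /andP[_ /set_mem/=] : (fun t => Normc.normc (x t)) \in Lfun mu 2%:E.
  apply: Lfun2_integrable; first exact: measurable_normc.
  by under eq_integral do rewrite normc_sqr; exact: L2fun_normc2_lty.
by rewrite /finite_norm ge0_fin_numE// Lnorm_ge0.
Qed.

(** The Cauchy-Schwarz estimate, for any integrand dominated by [|x| |y|], so that
    it serves both the real and the imaginary part of the inner product. *)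
Lemma Rintegral_L2_le (x y : H) (w : R -> R) :
  mu.-integrable setT (EFin \o w) ->
  (forall t, `|w t| <= Normc.normc (x t) * Normc.normc (y t)) ->
  `|\int[mu]_t w t| <= L2norm x * L2norm y.
Proof.
move=> iw wle; rewrite -lee_fin EFin_normr_Rintegral//.
rewrite /L2norm EFinM !fineK ?L2norm_fin//.
have mx := measurable_normc x; have my := measurable_normc y.
apply: le_trans (hoelder mu mx my _ _ _) => //; last by field.
have mw : measurable_fun setT (EFin \o w) := measurable_int _ iw.
rewrite Lnorm1; apply: le_trans (le_abse_integral mu measurableT mw) _.
apply: ge0_le_integral => //.
- exact: measurableT_comp.
- by apply: measurableT_comp => //; apply/measurable_EFinP; exact: measurable_funM.
- by move=> t _ /=; rewrite lee_fin [leRHS]ger0_norm// mulr_ge0// normc_ge0.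
Qed.

(** Working with the real part alone keeps all functionals real-valued; it still
    separates points, by [rdot_self]. *)
Definition rdot (x y : H) : R := Re (L2dot x y).

Lemma rdotE x y : rdot x y = \int[mu]_t Re (x t * conjc (y t)).
Proof. by []. Qed.

Lemma ae_eq_Rintegral (u v : R -> R) :
  measurable_fun setT u -> measurable_fun setT v ->
  {ae mu, forall t, u t = v t} -> \int[mu]_t u t = \int[mu]_t v t.
Proof.
move=> mu_ mv uv; congr fine; apply: ae_eq_integral => //.
- exact/measurable_EFinP.
- exact/measurable_EFinP.
by apply: filterS uv => t /= -> _.
Qed.

Lemma measurable_Re_dot (x y : H) : measurable_fun setT (fun t => Re (x t * conjc (y t))).
Proof. by apply/measurable_EFinP; exact: measurable_int (integrable_Re_dot x y). Qed.

Lemma L2dot_eq0 (x y : H) :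
  {ae mu, forall t, x t * conjc (y t) = 0} -> L2dot x y = 0.
Proof.
move=> xy.
have z (w : R -> R) : measurable_fun setT w -> {ae mu, forall t, w t = 0} ->
    \int[mu]_t w t = 0.
  move=> mw w0; rewrite (@ae_eq_Rintegral _ (fun=> 0))//.
  by rewrite Rintegral_cst// mul0r.
rewrite /L2dot !z//.
- by apply/measurable_EFinP; exact: measurable_int (integrable_Im_dot x y).
- by apply: filterS xy => t E; rewrite E.
- exact: measurable_Re_dot.
- by apply: filterS xy => t E; rewrite E.
Qed.

Lemma rdotD (x x' y : H) : rdot (x + x') y = rdot x y + rdot x' y.
Proof.
rewrite !rdotE -RintegralD//; try exact: integrable_Re_dot.
apply: ae_eq_Rintegral; first exact: measurable_Re_dot.
  by apply: measurable_funD; exact: measurable_Re_dot.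
by apply: filterS (L2funD x x') => t ->;
  case: (x t) (x' t) (y t) => [a b] [c e] [f k] /=; ring.
Qed.

Lemma rdotZ (r : R) (x y : H) : rdot (r%:C *: x) y = r * rdot x y.
Proof.
rewrite !rdotE -RintegralZl//; last exact: integrable_Re_dot.
apply: ae_eq_Rintegral; first exact: measurable_Re_dot.
  by apply: measurable_funM => //; exact: measurable_Re_dot.
apply: filterS (L2funZ r%:C x) => t ->; rewrite !Re_mulJ.
by case: (x t) => a b /=; ring.
Qed.

Lemma rdot_le (x y : H) : `|rdot x y| <= L2norm x * L2norm y.
Proof.
apply: Rintegral_L2_le; first exact: integrable_Re_dot.
by move=> t; apply: le_trans (normc_Re _) _; rewrite Normc.normcM normcJ.
Qed.

(** The factor 2 comes from estimating real and imaginary parts separately; only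
    boundedness of functionals is at stake, so the sharp constant is not
    pursued. *)
Lemma L2dot_le (x y : H) : Normc.normc (L2dot x y) <= 2 * (L2norm x * L2norm y).
Proof.
apply: le_trans (normc_le _) _; rewrite mulr_natl mulr2n; apply: lerD.
  exact: rdot_le.
apply: Rintegral_L2_le; first exact: integrable_Im_dot.
by move=> t; apply: le_trans (normc_Im _) _; rewrite Normc.normcM normcJ.
Qed.

Lemma rdot_self (x : H) : rdot x x = 0 -> x = 0.
Proof.
move=> x0; apply: L2_funP.
have x2 t : Re (x t * conjc (x t)) = normc2 (x t) by rewrite Re_mulJ.
have : (\int[mu]_t `|(normc2 (x t))%:E| = 0)%E.
  transitivity (\int[mu]_t (Re (x t * conjc (x t)))%:E)%E.
    by apply: eq_integral => t _; rewrite x2/= ger0_norm ?normc2_ge0.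
  rewrite -[LHS]fineK; last by exact: integrable_fin_num (integrable_Re_dot x x).
  by congr EFin; exact: x0.
have mn : measurable_fun setT (fun t => (normc2 (x t))%:E).
  apply/measurable_EFinP; apply: measurable_normc2.
    exact: measurable_Re.
  exact: measurable_Im.
move/(ae_eq_integral_abs mu measurableT mn) => n0.
apply: filterS2 n0 (L2funZ 0 (0 : H)) => t /(_ I) /= [n0t].
rewrite scaler0 mul0r => ->; move: n0t.
case: (x t) => a b /eqP; rewrite /normc2/= paddr_eq0 ?sqr_ge0// !sqrf_eq0.
by move=> /andP[/eqP -> /eqP ->].
Qed.

End L2Facts.

(** * Bounded functionals on trace-class operators *)
Section TraceFunctionals.
Context (R : realType).
Local Notation H := (L2 R).
Local Notation S1 := (traceclass R).

Let repr_set (T : S1) := [set r | exists u v, nuclear_rep T u v /\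
         r = limn (series (fun n => L2norm (u n) * L2norm (v n)))].

Let term_ge0 (u v : nat -> H) n : 0 <= L2norm (u n) * L2norm (v n).
Proof. by rewrite mulr_ge0// L2norm_ge0. Qed.

Let repr_lim_ge0 (T : S1) : lbound (repr_set T) 0.
Proof.
move=> r [u [v [[uv _] ->]]]; apply: limr_ge => //; apply: nearW => n.
by rewrite /series/= sumr_ge0.
Qed.

Lemma nuclear_repE (T : S1) : exists u v, nuclear_rep T u v.
Proof. by case: T => T /= /asboolP. Qed.

Let repr_set_neq0 (T : S1) : repr_set T !=set0.
Proof. by have [u [v uv]] := nuclear_repE T; eexists; exists u, v; split. Qed.

Lemma tcnorm_ge0 (T : S1) : 0 <= tcnorm T.
Proof. by apply: lb_le_inf; [exact: repr_set_neq0|exact: repr_lim_ge0]. Qed.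

Lemma tcnorm_le (T : S1) u v : nuclear_rep T u v ->
  tcnorm T <= limn (series (fun n => L2norm (u n) * L2norm (v n))).
Proof.
by move=> uv; apply: ge_inf; [exists 0; exact: repr_lim_ge0|exists u, v].
Qed.

Definition partial_sum (u v : nat -> H) n : S1 := \sum_(0 <= k < n) rank1 (u k) (v k).

Lemma partial_sumE u v n (x : H) :
  partial_sum u v n x = \sum_(0 <= k < n) L2dot x (v k) *: u k.
Proof.
rewrite /partial_sum; elim: n => [|n IH]; first by rewrite !big_geq.
by rewrite !big_nat_recr//= -IH.
Qed.

Let sum_shift (V : zmodType) (a : nat -> V) n N :
  \sum_(0 <= k < N) a (k + n)%N =
  \sum_(0 <= k < N + n) a k - \sum_(0 <= k < n) a k.
Proof.
apply/eqP; rewrite eq_sym subr_eq addrC.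
rewrite (@big_cat_nat _ _ _ n)//= ?leq_addl//; apply/eqP; congr (_ + _).
by rewrite -{1}[n]add0n big_addn addnK.
Qed.

Lemma nuclear_rep_shift (T : S1) u v n : nuclear_rep T u v ->
  nuclear_rep (T - partial_sum u v n) (fun k => u (k + n)%N) (fun k => v (k + n)%N).
Proof.
move=> [uv Tuv]; split.
  rewrite (_ : series _ = fun N =>
    series (fun n => L2norm (u n) * L2norm (v n)) (N + n)%N -
    series (fun n => L2norm (u n) * L2norm (v n)) n); last first.
    by apply/funext => N; exact: (sum_shift (fun k => L2norm (u k) * L2norm (v k))).
  apply: is_cvgB; last exact: is_cvg_cst.
  by case/cvg_ex: uv => l ul; apply/cvg_ex; exists l; rewrite cvg_shiftn.
move=> x; have := Tuv x; rewrite -(cvg_shiftn n) => Tuvx.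
apply: cvg_trans Tuvx; apply: near_eq_cvg; apply: nearW => N.
congr L2norm; rewrite (sum_shift (fun k => L2dot x (v k) *: u k)).
rewrite [(T - _) x](_ : _ = T x - partial_sum u v n x)//.
by rewrite opprB addrA partial_sumE subrK.
Qed.

(** Elementary tensors span a dense subspace: the remainder of a nuclear series is
    represented by its tail, whose length bounds its trace norm. *)
Lemma partial_sum_cvg (T : S1) u v : nuclear_rep T u v ->
  tcnorm (T - partial_sum u v n) @[n --> \oo] --> (0 : R).
Proof.
move=> uv; have [cuv _] := uv.
set a := series _ in cuv.
apply: (@squeeze_cvgr _ _ _ _ (fun=> 0) (fun n => limn a - a n)); last 2 first.
- exact: cvg_cst.
- by rewrite -(subrr (limn a)); apply: cvgB => //; exact: cvg_cst.
apply: nearW => n; rewrite tcnorm_ge0/=.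
apply: le_trans (tcnorm_le (nuclear_rep_shift n uv)) _.
rewrite le_eqVlt; apply/orP; left; apply/eqP.
apply/cvg_lim => //.
rewrite (_ : series _ = fun N => a (N + n)%N - a n); last first.
  by apply/funext => N; exact: (sum_shift (fun k => L2norm (u k) * L2norm (v k))).
by apply: cvgB; [rewrite cvg_shiftn|exact: cvg_cst].
Qed.

(** Density in the form in which it is used: a bounded additive functional is
    determined by its values on elementary tensors. *)
Lemma tc_functional_eq0 (Theta : S1 -> R) (C : R) :
  (forall S T, Theta (S + T) = Theta S + Theta T) ->
  (forall T, `|Theta T| <= C * tcnorm T) ->
  (forall x y, Theta (rank1 x y) = 0) -> forall T, Theta T = 0.
Proof.
move=> ThD Th_le Th1 T.
have Th0 : Theta 0 = 0 by apply: (addrI (Theta 0)); rewrite -ThD !addr0.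
have [u [v uv]] := nuclear_repE T.
have ThS n : Theta (T - partial_sum u v n) = Theta T.
  have ThP : Theta (partial_sum u v n) = 0.
    by rewrite (big_morph Theta ThD Th0) big1.
  by rewrite -[in RHS](subrK (partial_sum u v n) T) [RHS]ThD ThP addr0.
apply/eqP; rewrite -normr_le0.
have lim : C * tcnorm (T - partial_sum u v n) @[n --> \oo] --> (0 : R).
  by rewrite -(mulr0 C); apply: cvgMr; exact: partial_sum_cvg.
apply: (cvgr_to_ge lim); apply: nearW => n.
by rewrite -(ThS n); exact: Th_le.
Qed.

Definition matrix_coef (z w : H) (T : S1) : R := rdot (T z) w.

Lemma matrix_coefD z w S T :
  matrix_coef z w (S + T) = matrix_coef z w S + matrix_coef z w T.
Proof. exact: rdotD. Qed.

Lemma matrix_coefZ z w (r : R) T :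
  matrix_coef z w (r%:C *: T) = r * matrix_coef z w T.
Proof. exact: rdotZ. Qed.

(** Matrix coefficients are bounded for the trace norm: along any nuclear
    representation, [Re <T z, w>] is estimated term by term by the length of the
    series, and the trace norm is the infimum of these lengths. *)
Lemma matrix_coef_le z w : exists2 C, 0 < C &
  forall T, `|matrix_coef z w T| <= C * tcnorm T.
Proof.
(* The added 1 makes the constant positive, so that it can be divided by before
   comparing with the infimum. *)
pose C := 2 * (L2norm z * L2norm w) + 1.
have C0 : 0 < C by rewrite ltr_wpDl// !mulr_ge0// L2norm_ge0.
exists C => // T; rewrite mulrC -ler_pdivrMr//.
apply: lb_le_inf => [|_ [u [v [[uv Tuv] ->]]]]; first exact: repr_set_neq0.
rewrite ler_pdivrMr//; set L := limn _.
have rdot0 : rdot 0 w = 0 by have := rdotZ 0 0 w; rewrite scaler0 mul0r.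
have lim : L2norm (T z - \sum_(0 <= n < N) L2dot z (v n) *: u n) * L2norm w + L * C
     @[N --> \oo] --> L * C.
  rewrite -[X in _ --> X]add0r -(mul0r (L2norm w)).
  apply: cvgD; last exact: cvg_cst.
  by apply: cvgMl; exact: Tuv.
apply: (cvgr_to_ge lim); apply: nearW => N.
rewrite /matrix_coef -[T z](subrK (\sum_(0 <= n < N) L2dot z (v n) *: u n)).
rewrite rdotD addrK; apply: le_trans (ler_normD _ _) _; apply: lerD; first exact: rdot_le.
rewrite (big_morph (fun x : H => rdot x w) (fun x y => rdotD x y w) rdot0).
apply: (le_trans (ler_norm_sum _ _ _)).
apply: (@le_trans _ _ (series (fun n => L2norm (u n) * L2norm (v n)) N * C)); last first.
  rewrite ler_wpM2r ?(ltW C0)//; apply: nondecreasing_cvgn_le => //.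
  by apply: nondecreasing_series => k _ _; exact: term_ge0.
rewrite /series/= mulr_suml; apply: ler_sum => n _.
apply: le_trans (rdot_le _ _) _; rewrite L2normZ.
apply: (@le_trans _ _ (2 * (L2norm z * L2norm (v n)) * L2norm (u n) * L2norm w)).
  by rewrite !ler_wpM2r ?L2norm_ge0// L2dot_le.
rewrite (_ : _ * L2norm w =
  L2norm (u n) * L2norm (v n) * (2 * (L2norm z * L2norm w))); last by ring.
by rewrite ler_wpM2l ?term_ge0// lerDl.
Qed.

Lemma traceclass_ext (S T : S1) :
  (forall z w, matrix_coef z w S = matrix_coef z w T) -> S = T.
Proof.
move=> ST; apply: val_inj; apply/funext => z /=.
apply/eqP; rewrite -subr_eq0; apply/eqP; apply: rdot_self.
set w := _ - _; have : rdot (w + T z) w = rdot (T z) w by rewrite subrK; exact: ST.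
by rewrite rdotD -[RHS]add0r => /addIr.
Qed.

End TraceFunctionals.

(** * Dilations and the Haar measure *)
Section Haar.
Context (R : realType).
Local Notation leb := (@lebesgue_measure R).
Local Notation mu := (@haar R).
Local Notation RT := (measurableTypeR R).

Lemma measurable_mulr (r : R) : measurable_fun (setT : set RT) ( *%R r : RT -> RT).
Proof. exact: measurable_funM. Qed.

(** The factor [|r|] is the Jacobian that makes the image measure Lebesgue measure
    again. *)
Definition leb_dil (r : R) : {measure set RT -> \bar R} :=
  mscale `|r|%:nng (measure_function_pushforward__canonical__measure_function_Measure
    leb (measurable_mulr r)).

(** By uniqueness of Lebesgue measure it suffices to look at half-open intervals;
    a negative [r] moves the closed end to the left. *)
Lemma leb_dilE (r : R) (A : set RT) : r != 0 -> measurable A ->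
  leb_dil r A = leb A.
Proof.
move=> r0 mA; apply/esym/lebesgue_measure_unique => //= _ [[a b]] _ <-.
rewrite /mscale/= /pushforward.
have [rp|rn|r00] := ltgtP 0 r; last by rewrite -r00 eqxx in r0.
- rewrite (_ : _ @^-1` _ = `](r^-1 * a), (r^-1 * b)]%classic); last first.
    apply/seteqP; split => t /=; rewrite !in_itv/=;
    by rewrite ltr_pdivrMl// ler_pdivlMl.
  rewrite !lebesgue_measure_itv/= !lte_fin ltr_pM2l ?invr_gt0//.
  case: ifPn => _; last by rewrite mule0.
  by rewrite gtr0_norm// -!EFinD -EFinM -mulrBr mulVKf.
- rewrite (_ : _ @^-1` _ = `[(r^-1 * b), (r^-1 * a)[%classic); last first.
    apply/seteqP; split => t /=; rewrite !in_itv/=;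
    by rewrite ltr_ndivlMl// ler_ndivrMl// andbC.
  rewrite !lebesgue_measure_itv/= !lte_fin ltr_nM2l ?invr_lt0//.
  case: ifPn => _; last by rewrite mule0.
  by rewrite ltr0_norm// -!EFinD -EFinM -mulrBr mulNr mulVKf// opprB.
Qed.

(** The Jacobian [|r|] of the dilation is absorbed by the density:
    [|r| / |r t| = 1 / |t|]. *)
Lemma haar_dil (r : R) (A : set RT) : r != 0 -> measurable A ->
  mu ( *%R r @^-1` A) = mu A.
Proof.
move=> r0 mA; rewrite /haar.
have mr := measurable_mulr r.
have mrA : measurable ( *%R r @^-1` A) by rewrite -[X in measurable X]setTI; exact: mr.
pose g : RT -> \bar R := fun t => (`|t|^-1)%:E.
have mg (D : set RT) : measurable_fun D g.
  by apply/measurable_EFinP; exact: measurable_norm_inv.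
transitivity (\int[leb_dil r]_(t in A) g t)%E; last first.
  by apply: eq_measure_integral => B mB _; exact: leb_dilE.
rewrite ge0_integral_mscale//.
rewrite ge0_integral_pushforward//.
rewrite -ge0_integralZl//; last 2 first.
- by apply: measurableT_comp => //; exact: measurable_funS mr.
- by move=> t _; rewrite lee_fin.
apply: eq_integral => t _ /=; rewrite -EFinM normrM invfM mulVKf//.
by rewrite normr_eq0.
  by move=> t _; rewrite lee_fin.
by move=> t _; rewrite lee_fin.
Qed.

Lemma haar_integral_dil (r : R) (f : RT -> \bar R) : r != 0 ->
  measurable_fun setT f -> (forall t, 0 <= f t)%E ->
  (\int[mu]_t f (r * t)%R = \int[mu]_t f t)%E.
Proof.
move=> r0 mf f0.
pose nu := measure_function_pushforward__canonical__measure_function_Measure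
  mu (measurable_mulr r).
transitivity (\int[nu]_t f t)%E; last first.
  by apply: eq_measure_integral => A mA _; exact: haar_dil.
by rewrite ge0_integral_pushforward//; exact: measurable_mulr.
Qed.

Lemma haar_ae_dil (r : R) (P : R -> Prop) : r != 0 ->
  {ae mu, forall t, P t} -> {ae mu, forall t, P (r * t)}.
Proof.
move=> r0 [N [mN N0 PN]]; exists ( *%R r @^-1` N); split.
- by rewrite -[X in measurable X]setTI; exact: measurable_mulr.
- by rewrite haar_dil.
- by move=> t /= nP; exact: PN.
Qed.

Lemma haar_set1 (a : R) : mu [set a] = 0%E.
Proof. by rewrite /haar integral_set1. Qed.

Lemma haar_ae_neq (a : R) : {ae mu, forall t, t != a}.
Proof.
exists [set a]; split => //; first exact: haar_set1.
by move=> t /= /negP; rewrite negbK => /eqP.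
Qed.

Lemma haar_sigma_finite : sigma_finite setT mu.
Proof.
(* As [0^-1 = 0], the null point 0 lies in every [F n], and the [F n] exhaust the
   whole line. *)
pose F (n : nat) : set RT := [set t | `|t|^-1 <= n%:R] `&` `[- n%:R, n%:R]%classic.
have mF n : measurable (F n).
  apply: measurableI => //.
  rewrite (_ : [set t | _] = (fun t : R => `|t|^-1) @^-1` `]-oo, n%:R]); last first.
    by apply/seteqP; split => t /=; rewrite in_itv.
  by rewrite -[X in measurable X]setTI; exact: measurable_norm_inv.
exists F.
  apply/seteqP; split => // t _.
  pose k := maxn (Num.truncn `|t|^-1).+1 (Num.truncn `|t|).+1.
  have le1 : `|t|^-1 <= k%:R.
    apply: (@le_trans _ _ (Num.truncn `|t|^-1).+1%:R); first exact/ltW/truncnS_gt.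
    by rewrite ler_nat leq_maxl.
  have le2 : `|t| <= k%:R.
    apply: (@le_trans _ _ (Num.truncn `|t|).+1%:R); first exact/ltW/truncnS_gt.
    by rewrite ler_nat leq_maxr.
  by exists k => //; split => //=; rewrite in_itv/= -ler_norml.
move=> n; split => //; rewrite /haar.
apply: (@le_lt_trans _ _ (\int[leb]_(t in F n) (cst n%:R%:E) t)%E).
  apply: ge0_le_integral => //.
  - by apply/measurable_EFinP; exact: measurable_norm_inv.
  - by move=> t [? _]; rewrite lee_fin.
rewrite integral_cst//.
apply: lte_mul_pinfty => //.
apply: (@le_lt_trans _ _ (leb `[- n%:R, n%:R]%classic)).
  by apply: le_measure; rewrite ?inE//; exact: subIsetr.
by rewrite lebesgue_measure_itv/=; case: ifP => _; rewrite ltry.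
Qed.

HB.instance Definition _ :=
  @Measure_isSigmaFinite.Build _ _ _ (@haar R) haar_sigma_finite.

End Haar.

Section Products.
Context (R : realType).
Local Notation mu := (@haar R).
Local Notation RT := (measurableTypeR R).
Local Notation H := (L2 R).

Lemma measurable_L2fun_normc2 (x : H) :
  measurable_fun (setT : set RT) (fun t => normc2 (x t)).
Proof.
by apply: measurable_normc2; [exact: measurable_Re|exact: measurable_Im].
Qed.

Lemma sqint_dilate (r : R) (x : H) : r != 0 -> sqint (fun t => x (r * t)).
Proof.
move=> r0; apply: sqintI.
- exact: (measurableT_comp (measurable_Re x) (measurable_mulr r)).
- exact: (measurableT_comp (measurable_Im x) (measurable_mulr r)).
rewrite (haar_integral_dil (f := fun t => (normc2 (x t))%:E) r0).
- exact: L2fun_normc2_lty.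
- by apply/measurable_EFinP; exact: measurable_L2fun_normc2.
- by move=> t; rewrite lee_fin normc2_ge0.
Qed.

Lemma dilateE (r : R) (x : H) : r != 0 ->
  {ae mu, forall t, dilate r x t = x (r^-1 * t)}.
Proof. by move=> r0; apply: toL2E; apply: sqint_dilate; rewrite invr_eq0. Qed.

(** By Tonelli and dilation invariance, the integral over [h] of the left-hand side
    is the product of the squared norms of [x] and [x']. *)
Lemma ae_fiber_lty (x x' : H) :
  {ae mu, forall h, (\int[mu]_s (normc2 (x s) * normc2 (x' (h * s)%R))%:E < +oo)%E}.
Proof.
pose f (p : RT * RT) : \bar R := (normc2 (x p.2) * normc2 (x' (p.1 * p.2)%R))%:E.
have mf : measurable_fun setT f.
  apply/measurable_EFinP; apply: measurable_funM.
    exact: (measurableT_comp (measurable_L2fun_normc2 x) measurable_snd).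
  apply: (measurableT_comp (measurable_L2fun_normc2 x')).
  by apply: measurable_funM; [exact: measurable_fst|exact: measurable_snd].
have f0 p : (0 <= f p)%E by rewrite lee_fin mulr_ge0 ?normc2_ge0.
pose F h := (\int[mu]_s f (h, s))%E.
pose G s := (\int[mu]_h f (h, s))%E.
have FG : (\int[mu]_h F h = \int[mu]_s G s)%E.
  exact: (fubini_tonelli (m1 := mu) (m2 := mu) f mf f0).
have mF : measurable_fun setT F.
  exact: (measurable_fun_fubini_tonelli_F (m2 := mu) f mf f0).
have mG : measurable_fun setT G.
  exact: (measurable_fun_fubini_tonelli_G (m1 := mu) f mf f0).
have F0 h : (0 <= F h)%E by exact: integral_ge0.
have G0 s : (0 <= G s)%E by exact: integral_ge0.
pose K := (\int[mu]_t (normc2 (x' t))%:E)%E.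
have K0 : (0 <= K)%E by apply: integral_ge0 => t _; rewrite lee_fin normc2_ge0.
have mE (y : H) : measurable_fun (setT : set RT) (fun t => (normc2 (y t))%:E).
  by apply/measurable_EFinP; exact: measurable_L2fun_normc2.
have E0 (y : H) t : (0 <= (normc2 (y t))%:E)%E by rewrite lee_fin normc2_ge0.
have GE s : s != 0 -> G s = ((normc2 (x s))%:E * K)%E.
  move=> s0; rewrite /K -(haar_integral_dil s0)// /G /f/=.
  under eq_integral do rewrite EFinM mulrC.
  rewrite ge0_integralZl//.
  exact: (measurableT_comp (mE x') (measurable_mulr s)).
have Goo : (\int[mu]_s G s < +oo)%E.
  apply: (@le_lt_trans _ _ (\int[mu]_s ((normc2 (x s))%:E * K))%E).
    apply: ae_le_lower_integral => //; first by move=> s; exact: mule_ge0.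
    by apply: filterS (haar_ae_neq (0:R)) => s s0; rewrite GE.
  rewrite ge0_integralZr//; apply: lte_mul_pinfty => //.
  - exact: integral_ge0.
  - by rewrite ge0_fin_numE ?integral_ge0// L2fun_normc2_lty.
  - exact: L2fun_normc2_lty.
have iF : mu.-integrable setT F.
  apply/integrableP; split => //; under eq_integral do rewrite gee0_abs//.
  by rewrite FG.
apply: filterS (integrable_ae measurableT iF) => h /(_ I).
by rewrite ge0_fin_numE.
Qed.

Lemma measurable_ReM (x y : H) : measurable_fun setT (fun t => Re (x t * y t)).
Proof.
rewrite (_ : (fun _ => _) =
  fun t => Re (x t) * Re (y t) - Im (x t) * Im (y t)); last first.
  by apply/funext => t; case: (x t) (y t) => a b [c d].
by apply: measurable_funB; apply: measurable_funM;
  (exact: measurable_Re || exact: measurable_Im).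
Qed.

Lemma measurable_ImM (x y : H) : measurable_fun setT (fun t => Im (x t * y t)).
Proof.
rewrite (_ : (fun _ => _) =
  fun t => Re (x t) * Im (y t) + Im (x t) * Re (y t)); last first.
  by apply/funext => t; case: (x t) (y t) => a b [c d].
by apply: measurable_funD; apply: measurable_funM;
  (exact: measurable_Re || exact: measurable_Im).
Qed.

Lemma dilation_factors_neq0 (h : R) : h != 0 -> h != -1 ->
  1 + h != 0 /\ 1 + h^-1 != 0.
Proof.
move=> h0 h1; have a0 : 1 + h != 0 by rewrite addrC addr_eq0.
by rewrite (_ : 1 + h^-1 = (1 + h) / h) ?mulf_neq0 ?invr_eq0//; field.
Qed.

(** The products under the integral defining the dual convolution are honest
    elements of L^2 for almost every [h]: the substitution [t = (1 + h) s] changes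
    [t / (1 + h^-1)] into [h s], which reduces the claim to
    [ae_fiber_lty]. *)
Lemma ae_sqint_product (x x' : H) : {ae mu, forall h : R,
  sqint (fun t => dilate (1 + h) x t * dilate (1 + h^-1) x' t)}.
Proof.
apply: filterS3 (haar_ae_neq (0:R)) (haar_ae_neq (-1 : R)) (ae_fiber_lty x x').
move=> h h0 h1 foo.
have [a0 b0] := dilation_factors_neq0 h0 h1.
pose Phi (s : R) := (normc2 (x s) * normc2 (x' (h * s)))%:E.
have mPhi : measurable_fun (setT : set RT) Phi.
  apply/measurable_EFinP; apply: measurable_funM; first exact: measurable_L2fun_normc2.
  exact: (measurableT_comp (measurable_L2fun_normc2 x') (measurable_mulr h)).
have Phi0 s : (0 <= Phi s)%E by rewrite lee_fin mulr_ge0 ?normc2_ge0.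
apply: sqintI; [exact: measurable_ReM|exact: measurable_ImM|].
apply: le_lt_trans foo.
have a0' : (1 + h)^-1 != 0 by rewrite invr_eq0.
rewrite -[leRHS](haar_integral_dil a0' mPhi Phi0) le_eqVlt; apply/orP; left; apply/eqP.
apply: ae_eq_integral => //.
- apply/measurable_EFinP; apply: measurable_normc2.
    exact: measurable_ReM.
  exact: measurable_ImM.
- exact: (measurableT_comp mPhi (measurable_mulr _)).
apply: filterS2 (dilateE x a0) (dilateE x' b0) => t -> -> _.
rewrite /Phi normc2M; congr (_ * normc2 (x' _))%:E.
by field; rewrite a0 h0.
Qed.

End Products.

(** * Half-line projections and dilated products *)
Section HalfLines.
Context (R : realType).
Local Notation mu := (@haar R).
Local Notation RT := (measurableTypeR R).
Local Notation H := (L2 R).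

Definition halfline (b : bool) (t : R) : bool := if b then 0 < t else t < 0.

(** A dilation permutes the two half-lines according to the sign of its ratio.
    This is the whole sign combinatorics of the theorem. *)
Lemma halfline_mul b r t : r != 0 -> halfline b (r * t) = halfline (b == (0 < r)) t.
Proof.
rewrite /halfline neq_lt => /orP[r0|r0].
  by rewrite (lt_gtF r0); case: b; rewrite /= ?nmulr_rgt0 ?nmulr_rlt0.
by rewrite r0; case: b; rewrite /= ?pmulr_rgt0 ?pmulr_rlt0.
Qed.

Lemma halfline_exclusive b t : halfline b t && halfline (~~ b) t = false.
Proof.
by apply/negP => /andP[]; case: b => /= h1 h2; have := lt_trans h1 h2; rewrite ltxx.
Qed.

Lemma halflineN b t : t != 0 -> halfline (~~ b) t = ~~ halfline b t.
Proof.
move=> t0; case: b; rewrite /halfline/= -leNgt le_eqVlt ?(negbTE t0)//.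
by rewrite eq_sym (negbTE t0).
Qed.

Definition halfline_restr b (x : H) (t : R) : R[i] := if halfline b t then x t else 0.

Lemma sqint_halfline_restr b (x : H) : sqint (halfline_restr b x).
Proof.
have mh : measurable_fun (setT : set RT) (halfline b).
  by case: b; apply: measurable_fun_ltr.
have mc (f : R[i] -> R) : f 0 = 0 -> measurable_fun (setT : set RT) (fun t => f (x t)) ->
    measurable_fun (setT : set RT) (fun t => f (halfline_restr b x t)).
  move=> f0 mf; rewrite (_ : (fun _ => _) = fun t => if halfline b t then f (x t) else 0).
    exact: measurable_fun_ifT.
  by apply/funext => t; rewrite /halfline_restr; case: ifP.
have mR := mc (@Re R) erefl (measurable_Re x).
have mI := mc (@Im R) erefl (measurable_Im x).
apply: sqintI => //; apply: le_lt_trans (L2fun_normc2_lty x).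
apply: ge0_le_integral => //.
- by move=> t _; rewrite lee_fin normc2_ge0.
- by apply/measurable_EFinP; exact: measurable_normc2.
- by apply/measurable_EFinP; exact: measurable_L2fun_normc2.
- move=> t _; rewrite lee_fin /halfline_restr; case: ifP => // _.
  by rewrite [leLHS](_ : _ = 0) ?normc2_ge0// /normc2/= expr0n/= addr0.
Qed.

Definition halfspace b : set H := if b then @Hplus R else @Hminus R.
Definition half_proj b : H -> H := if b then @Pplus R else @Pminus R.

Lemma half_projE b : half_proj b = orth_proj (halfspace b).
Proof. by case: b. Qed.

Lemma halfspaceP b x : halfspace b x <-> {ae mu, forall t, halfline (~~ b) t -> x t = 0}.
Proof. by case: b. Qed.

(** The orthogonality conditions determine the projection: if [u] and [v] both
    satisfy them, [u - v] is in [K] and orthogonal to itself. *)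
Lemma orth_proj_eq (K : set H) (x z : H) :
  (forall u v, K u -> K v -> K (u - v)) ->
  K z -> (forall k, K k -> L2dot (x - z) k = 0) -> orth_proj K x = z.
Proof.
move=> KB Kz xz; rewrite /orth_proj; apply: xget_subset1; first by split.
move=> u v [Ku xu] [Kv xv]; apply/eqP; rewrite -subr_eq0; apply/eqP.
have Kuv := KB _ _ Ku Kv; apply: rdot_self.
have := rdotD (x - u) (u - v) (u - v); rewrite addrA subrK.
by rewrite /rdot xu// xv//= add0r.
Qed.

Lemma half_proj_ae b (x : H) :
  {ae mu, forall t, half_proj b x t = halfline_restr b x t}.
Proof.
pose z := toL2 (halfline_restr b x).
have zE : {ae mu, forall t, z t = halfline_restr b x t} := toL2E (sqint_halfline_restr b x).
suff -> : half_proj b x = z by [].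
rewrite half_projE; apply: orth_proj_eq.
- move=> u v /halfspaceP hu /halfspaceP hv; apply/halfspaceP.
  apply: filterS3 hu hv (filterI (L2funD u (- v)) (L2funZ (-1) v)) => t ut vt [+ +] ht.
  by rewrite scaleN1r => -> ->; rewrite ut// vt// mulr0 addr0.
- apply/halfspaceP; apply: filterS zE => t -> ht; rewrite /halfline_restr.
  by case: ifP => // hb; have := halfline_exclusive b t; rewrite hb ht.
- move=> k /halfspaceP hk; apply: L2dot_eq0.
  apply: filterS3 (filterI hk (haar_ae_neq (0:R))) zE
    (filterI (L2funD x (- z)) (L2funZ (-1) z)) => t [kt t0] zt [+ +].
  rewrite scaleN1r => -> ->; rewrite zt /halfline_restr; case: ifPn => hb.
    by rewrite mulN1r subrr mul0r.
  by rewrite kt ?halflineN// conjc0 mulr0.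
Qed.

(** The vector-valued factors of the integrand of the dual convolution: the
    integrand is [rank1 (dilprod h x x') (dilprod h y y')]. *)
Definition dilprod (h : R) (x x' : H) : H :=
  L2mul (dilate (1 + h) x) (dilate (1 + h^-1) x').

(** [L2mul] returns 0 outside L^2, and then its value says nothing about the
    product; computations are valid under this proviso, which holds for almost
    every [h]. *)
Definition dilprod_sqint (h : R) (x x' : H) : Prop :=
  sqint (fun t => dilate (1 + h) x t * dilate (1 + h^-1) x' t).

Section Pointwise.
Variable h : R.
Hypotheses (h0 : 1 + h != 0) (h1 : 1 + h^-1 != 0).

Lemma dilprodE x x' : dilprod_sqint h x x' -> {ae mu, forall t,
  dilprod h x x' t = x ((1 + h)^-1 * t) * x' ((1 + h^-1)^-1 * t)}.
Proof.
move=> g; apply: filterS3 (toL2E g) (dilateE x h0) (dilateE x' h1) => t.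
by rewrite /dilprod /L2mul => -> -> ->.
Qed.

(** Dilating the half-line of sign [b] by [1 + h] gives the half-line of sign
    [b == (0 < 1 + h)], and likewise for the other factor.  Either the two dilated
    half-lines coincide, and the product is cut to that half-line, or they are
    disjoint, and the product vanishes. *)
Lemma dilprod_proj b c x x' :
  dilprod_sqint h x x' -> dilprod_sqint h (half_proj b x) (half_proj c x') ->
  dilprod h (half_proj b x) (half_proj c x') =
    if (b == (0 < 1 + h)) == (c == (0 < 1 + h^-1))
    then half_proj (b == (0 < 1 + h)) (dilprod h x x') else 0.
Proof.
move=> g gp.
have r0 : (1 + h)^-1 != 0 by rewrite invr_eq0.
have r1 : (1 + h^-1)^-1 != 0 by rewrite invr_eq0.
have px := haar_ae_dil r0 (half_proj_ae b x).
have px' := haar_ae_dil r1 (half_proj_ae c x').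
apply: L2_funP.
have E : {ae mu, forall t, dilprod h (half_proj b x) (half_proj c x') t =
   if halfline (b == (0 < 1 + h)) t && halfline (c == (0 < 1 + h^-1)) t
   then x ((1 + h)^-1 * t) * x' ((1 + h^-1)^-1 * t) else 0}.
  apply: filterS3 (dilprodE gp) px px' => t -> -> ->.
  rewrite /halfline_restr !halfline_mul// !invr_gt0.
  by case: halfline; case: halfline; rewrite ?mul0r ?mulr0.
case: eqP => [bc|/eqP bc].
  apply: filterS3 E (half_proj_ae (b == (0 < 1 + h)) (dilprod h x x'))
    (dilprodE g) => t -> ->.
  by rewrite -bc andbb /halfline_restr => ->.
apply: filterS2 E (L2funZ 0 (0 : H)) => t -> /=; rewrite scaler0 mul0r => ->.
have -> : (c == (0 < 1 + h^-1)) = ~~ (b == (0 < 1 + h)).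
  by move: bc; case: (b == _); case: (c == _).
by rewrite halfline_exclusive.
Qed.

Lemma rank1_00 : rank1 (0 : H) 0 = 0.
Proof. by apply: val_inj; apply/funext => z /=; rewrite scaler0. Qed.

(** For fixed signs of [1 + h] and [1 + h^-1], exactly two of the four pairs
    [(b, c)] survive in [dilprod_proj], one for each half-line; their
    tensors are the two terms on the left. *)
Lemma rank1_dilprod_proj x x' y y' :
  dilprod_sqint h x x' -> dilprod_sqint h y y' ->
  (forall b c, dilprod_sqint h (half_proj b x) (half_proj c x')) ->
  (forall b c, dilprod_sqint h (half_proj b y) (half_proj c y')) ->
  let F b c := rank1 (dilprod h (half_proj b x) (half_proj c x'))
                     (dilprod h (half_proj b y) (half_proj c y')) in
  rank1 (half_proj true (dilprod h x x')) (half_proj true (dilprod h y y')) +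
  rank1 (half_proj false (dilprod h x x')) (half_proj false (dilprod h y y')) =
  F true true + F true false + (F false true + F false false).
Proof.
move=> gx gy gpx gpy F; rewrite /F !dilprod_proj//; clear F.
by case: (0 < 1 + h); case: (0 < 1 + h^-1) => /=;
  rewrite !rank1_00 ?addr0 ?add0r// addrC.
Qed.

End Pointwise.
End HalfLines.

(** * The homomorphism property *)
Section Homomorphism.
Context (R : realType).
Local Notation mu := (@haar R).
Local Notation H := (L2 R).
Local Notation S1 := (traceclass R).
Variables (B : S1 -> S1 -> S1) (P : S1 -> S1).
Hypotheses (BP : is_dual_convolution B) (PP : is_Pdiag P).

Let PD S T : P (S + T) = P S + P T.
Proof. by have [lP _ _] := PP; have := lP 1 S T; rewrite !scale1r. Qed.

Let P0 : P 0 = 0.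
Proof. by apply: (addrI (P 0)); rewrite -PD !addr0. Qed.

Let PZ a T : P (a *: T) = a *: P T.
Proof. by have [lP _ _] := PP; have := lP a T 0; rewrite P0 !addr0. Qed.

Let P_le : exists2 M, 0 <= M & forall T, tcnorm (P T) <= M * tcnorm T.
Proof.
have [_ [M PM] _] := PP; exists `|M| => // T.
by apply: le_trans (PM T) _; rewrite ler_wpM2r ?tcnorm_ge0// ler_norm.
Qed.

Let BDr S T T' : B S (T + T') = B S T + B S T'.
Proof. by have [lB _ _ _] := BP; have := lB S 1 T T'; rewrite !scale1r. Qed.

Let BDl S S' T : B (S + S') T = B S T + B S' T.
Proof. by have [_ lB _ _] := BP; have := lB T 1 S S'; rewrite !scale1r. Qed.

Let B_le S T : tcnorm (B S T) <= tcnorm S * tcnorm T.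
Proof. by have [_ _ + _] := BP. Qed.

Let P_rank1 x y : P (rank1 x y) =
  rank1 (half_proj true x) (half_proj true y) +
  rank1 (half_proj false x) (half_proj false y).
Proof. by have [_ _ ->] := PP. Qed.

Let B_weak (psi : S1 -> R) (C : R) x y x' y' : 0 < C ->
  (forall u v, psi (u + v) = psi u + psi v) ->
  (forall (r : R) v, psi (r%:C *: v) = r * psi v) ->
  (forall v, `|psi v| <= C * tcnorm v) ->
  exists g : R -> R, [/\ mu.-integrable setT (EFin \o g),
    {ae mu, forall h, psi (rank1 (dilprod h x x') (dilprod h y y')) = g h} &
    (\int[mu]_h (g h)%:E = (psi (B (rank1 x y) (rank1 x' y')))%:E)%E].
Proof.
move=> C0 psiD psiZ psi_le; have [_ _ _ Bint] := BP.
exact: (bochner_weak (@tcnorm_ge0 R) psiD psiZ C0 psi_le (Bint x y x' y')).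
Qed.

(** Tested against a matrix coefficient, both sides are ordinary integrals over
    [h], of functions which agree almost everywhere by
    [rank1_dilprod_proj]. *)
Lemma Pdiag_dual_convolution_rank1 x y x' y' :
  P (B (rank1 x y) (rank1 x' y')) = B (P (rank1 x y)) (P (rank1 x' y')).
Proof.
apply: traceclass_ext => z w; have [C C0 psi_le] := matrix_coef_le z w.
move: (matrix_coef z w) psi_le (matrix_coefD z w) (matrix_coefZ z w).
move=> psi psi_le psiD psiZ.
have [M M0 PM] := P_le.
have [||||g [ig eg Ig]] := @B_weak (psi \o P) (C * M + 1) x y x' y'.
- by rewrite ltr_wpDl// mulr_ge0// ltW.
- by move=> u v /=; rewrite PD psiD.
- by move=> r v /=; rewrite PZ psiZ.
- move=> v /=; apply: le_trans (psi_le _) _.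
  apply: (@le_trans _ _ (C * M * tcnorm v)); first by rewrite -mulrA ler_wpM2l// ltW.
  by rewrite ler_wpM2r ?tcnorm_ge0// lerDl.
(* The right-hand side expands into four dual convolutions of elementary tensors,
   each of which is an integral. *)
have W b c := @B_weak psi C (half_proj b x) (half_proj b y)
  (half_proj c x') (half_proj c y')
  C0 psiD psiZ psi_le.
have [g11 [i11 e11 I11]] := W true true.
have [g10 [i10 e10 I10]] := W true false.
have [g01 [i01 e01 I01]] := W false true.
have [g00 [i00 e00 I00]] := W false false.
rewrite !P_rank1 !(BDl, BDr) !psiD; apply: EFin_inj.
rewrite -[LHS]Ig !EFinD -I11 -I10 -I01 -I00.
have i1 := integrableD measurableT i11 i10.
have i0 := integrableD measurableT i01 i00.
rewrite -(integralD measurableT i11 i10) -(integralD measurableT i01 i00).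
rewrite -(integralD measurableT i1 i0).
apply: ae_eq_integral => //.
- exact: measurable_int ig.
- exact: measurable_int (integrableD measurableT i1 i0).
have ae_y := ae_sqint_product y y'; have ae_x := ae_sqint_product x x'.
have ae_px b c := ae_sqint_product (half_proj b x) (half_proj c x').
have ae_py b c := ae_sqint_product (half_proj b y) (half_proj c y').
have ae_all (Q : bool -> bool -> R -> Prop) :
    (forall b c, {ae mu, forall h, Q b c h}) -> {ae mu, forall h, forall b c, Q b c h}.
  move=> aeQ; apply: filterS (filterI (filterI (aeQ true true) (aeQ true false))
    (filterI (aeQ false true) (aeQ false false))) => h [[? ?] [? ?]].
  by do 2 case.
apply: filterS3 (filterI (haar_ae_neq (0:R)) (haar_ae_neq (-1 : R)))
  (filterI (filterI ae_x ae_y) (filterI (ae_all _ ae_px) (ae_all _ ae_py)))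
  (filterI eg (filterI (filterI e11 e10) (filterI e01 e00))) =>
  h [h0 h1] [[gx gy] [gpx gpy]] [E [[E11 E10] [E01 E00]]] _ /=.
rewrite -E -E11 -E10 -E01 -E00 /=.
have [a0 b0] := dilation_factors_neq0 h0 h1.
rewrite P_rank1 (rank1_dilprod_proj a0 b0 gx gy gpx gpy).
by rewrite !psiD !EFinD.
Qed.

(** The difference of the two sides, tested against a matrix coefficient, is a
    bounded biadditive form; density is applied to one variable, then to the
    other. *)
Lemma Pdiag_dual_convolution S T : P (B S T) = B (P S) (P T).
Proof.
apply: traceclass_ext => z w; have [C C0 psi_le] := matrix_coef_le z w.
move: (matrix_coef z w) psi_le (matrix_coefD z w) (matrix_coefZ z w).
move=> psi psi_le psiD psiZ.
have psiB u v : psi (u - v) = psi u - psi v.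
  by apply/eqP; rewrite eq_sym subr_eq -psiD subrK.
have [M M0 PM] := P_le.
pose Theta S T := psi (P (B S T) - B (P S) (P T)).
suff Th0 : forall S T, Theta S T = 0.
  by apply/eqP; rewrite -subr_eq0 -psiB; apply/eqP; exact: Th0.
have ThDl S1 S2 T' : Theta (S1 + S2) T' = Theta S1 T' + Theta S2 T'.
  by rewrite /Theta -psiD BDl !PD BDl opprD addrACA.
have ThDr S' T1 T2 : Theta S' (T1 + T2) = Theta S' T1 + Theta S' T2.
  by rewrite /Theta -psiD BDr !PD BDr opprD addrACA.
have Th_le S' T' : `|Theta S' T'| <=
    C * (M + M * M) * (tcnorm S' * tcnorm T').
  have n0 := @tcnorm_ge0 R.
  rewrite /Theta psiB; apply: le_trans (ler_normB _ _) _.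
  rewrite mulrDr mulrDl; apply: lerD.
    apply: le_trans (psi_le _) _; rewrite -mulrA; apply: (ler_wpM2l (ltW C0)).
    by apply: le_trans (PM _) _; rewrite ler_wpM2l.
  apply: le_trans (psi_le _) _; rewrite -mulrA; apply: (ler_wpM2l (ltW C0)).
  by apply: le_trans (B_le _ _) _; rewrite mulrACA ler_pM.
move=> S' T'; move: S'.
apply: (@tc_functional_eq0 _ (Theta^~ T') (C * (M + M * M) * tcnorm T')) => //.
- move=> S'; apply: le_trans (Th_le _ _) _.
  by rewrite le_eqVlt (_ : _ == _)//; apply/eqP; ring.
move=> x y; move: T'.
apply: (@tc_functional_eq0 _ (Theta (rank1 x y))
  (C * (M + M * M) * tcnorm (rank1 x y))) => //.
- move=> T'; apply: le_trans (Th_le _ _) _.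
  by rewrite le_eqVlt (_ : _ == _)//; apply/eqP; ring.
move=> x' y'; rewrite /Theta Pdiag_dual_convolution_rank1 subrr.
by rewrite -(subrr (0 : S1)) psiB subrr.
Qed.

End Homomorphism.

Theorem proposition5p3 (R : realType)
  (dconv : traceclass R -> traceclass R -> traceclass R)
  (Pdiag : traceclass R -> traceclass R)
  (dconvP : is_dual_convolution dconv)
  (PdiagP : is_Pdiag Pdiag)
  (T1 T2 : traceclass R) :
  Pdiag (dconv T1 T2) = dconv (Pdiag T1) (Pdiag T2).
Proof. exact: (Pdiag_dual_convolution dconvP PdiagP). Qed.
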